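(* Let $p$ be a prime, $q$ a power of $p$, and let $f=\sum_{i=0}^d f_iX^i\in\mathbb{F}_q[T][X]$ be irreducible with $f_d\ne 0$ and $d\ge 2$. Then as $n\to\infty$ (with $f,q$ fixed): (i) $\deg L_f(n)\gtrsim \frac{d-1}{d}\, n q^n$; (ii) if $p\nmid d$ or $f_d\nmid f_{d-1}$ (divisibility in $\mathbb{F}_q[T]$), then $\deg L_f(n)\gtrsim n q^n$.
   Context: $M_n$ denotes the set of monic polynomials of degree $n$ in $\mathbb{F}_q[T]$. For $n$ large enough that $f(Q)\neq 0$ for all $Q\in M_n$, set $L_f(n)=\mathrm{lcm}(f(Q):Q\in M_n)$; $\deg$ denotes degree in $T$. For positive functions $A(n),B(n)$, $A\gtrsim B$ means $\liminf_{n\to\infty}A(n)/B(n)\ge 1$. *)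

(* Defs.v *)
From HB Require Import structures.
From mathcomp Require Import all_boot all_order all_algebra.
From mathcomp Require Import reals ereal sequences.

Set Implicit Arguments.
Unset Strict Implicit.
Unset Printing Implicit Defensive.

Import Order.TTheory GRing.Theory Num.Theory.

Local Open Scope ring_scope.

(* Irreducibility in the sense of ring theory. On {poly {poly F}} this differs
   from the library's irreducible_poly, which uses pseudo-division and hence
   only expresses irreducibility over the fraction field of {poly F}: a
   non-primitive polynomial such as T * (X ^ 2 - T) is excluded here. *)
Definition ring_irreducible (A : unitRingType) (a : A) : Prop :=
  [/\ a != 0, a \isn't a GRing.unit &
      forall b c : A, a = b * c -> b \is a GRing.unit \/ c \is a GRing.unit].

Definition monics (F : finFieldType) (n : nat) : seq {poly F} :=
  [seq 'X^n + rVpoly v | v : 'rV[F]_n].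

Lemma mem_monics (F : finFieldType) (n : nat) (Q : {poly F}) :
  (Q \in monics F n) = (Q \is monic) && (size Q == n.+1).
Proof.
apply/mapP/andP => [[v _ ->]|[Qm /eqP sQ]].
  have sv : (size (rVpoly v) < size ('X^n : {poly F}))%N.
    by rewrite size_polyXn ltnS size_poly.
  by rewrite monicE lead_coefDl // lead_coefXn size_polyDl // size_polyXn !eqxx.
exists (poly_rV (Q - 'X^n)); first by rewrite mem_enum.
suff sz : (size (Q - 'X^n)%R <= n)%N by rewrite poly_rV_K // addrC subrK.
apply/leq_sizeP => j; rewrite leq_eqVlt coefB coefXn => /orP[/eqP <-|nj].
  by move: Qm; rewrite monicE lead_coefE sQ /= eqxx => /eqP ->; rewrite subrr.
by rewrite nth_default ?sQ // gtn_eqF // subr0.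
Qed.

Lemma uniq_monics (F : finFieldType) (n : nat) : uniq (monics F n).
Proof.
rewrite map_inj_uniq ?enum_uniq //.
by move=> u v /addrI /(can_inj rVpolyK).
Qed.

Definition lcmp (F : fieldType) (a b : {poly F}) : {poly F} :=
  (a * b) %/ gcdp a b.

Lemma dvdp_lcm (F : fieldType) (a b m : {poly F}) :
  (lcmp a b %| m) = (a %| m) && (b %| m).
Proof.
have [->|a0] := eqVneq a 0.
  rewrite /lcmp mul0r div0p dvd0p.
  by case: eqVneq => // ->; rewrite dvdp0.
have [->|b0] := eqVneq b 0.
  rewrite /lcmp mulr0 div0p dvd0p.
  by case: eqVneq => [->|]; rewrite ?dvdp0 ?andbF.
have g0 : gcdp a b != 0 by rewrite gcdp_eq0 negb_and a0.
rewrite -[LHS](dvdp_mul2r _ _ g0) /lcmp (divpK (dvdp_mulr b (dvdp_gcdl a b))).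
rewrite (eqp_dvdr _ (mulp_gcdr a b m)) dvdp_gcd andbC dvdp_mul2r //.
by rewrite [a * b]mulrC dvdp_mul2r.
Qed.

(* L_f(n) up to a nonzero constant of F. *)
Definition lcm_values (F : finFieldType) (f : {poly {poly F}}) (n : nat) :
    {poly F} :=
  \big[@lcmp F/1]_(Q <- monics F n) f.[Q].

Lemma lcm_valuesP (F : finFieldType) (f : {poly {poly F}}) (n : nat)
    (m : {poly F}) :
  reflect (forall Q : {poly F}, Q \is monic -> size Q = n.+1 -> f.[Q] %| m)
          (lcm_values f n %| m).
Proof.
have -> : (lcm_values f n %| m) = all (fun Q => f.[Q] %| m) (monics F n).
  rewrite /lcm_values; elim: (monics F n) => [|Q s IH].
    by rewrite big_nil dvd1p.
  by rewrite big_cons dvdp_lcm IH.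
apply: (iffP allP) => [h Q Qm sQ|h Q].
  by apply: h; rewrite mem_monics Qm sQ eqxx.
by rewrite mem_monics => /andP[Qm /eqP]; apply: h.
Qed.

(* Degree, with the harmless convention deg 0 = 0. *)
Definition deg (F : fieldType) (a : {poly F}) : nat := (size a).-1.

Definition asymp_ge (R : realType) (A B : nat -> R) : Prop :=
  (1 <= limn_einf (fun n => (A n / B n)%:E))%E.

(* Main.v *)
Require Import Defs.
From HB Require Import structures.
From mathcomp Require Import all_boot all_order all_algebra.
From mathcomp Require Import reals ereal sequences.
From mathcomp Require Import all_field perm topology.
From mathcomp Require Import zify ring.

(** Let q = #|F|. The product of the values f(Q) over monic Q of degree n has
    degree at least d n q^n, distributed over the monic irreducible P.

    Small primes, deg P <= n + O(1), account for at most n q^n + O(q^n). The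
    main term is the upper bound in Mertens' theorem,
      sum_(deg P <= n) deg P rho(P) / |P| <= n + O(1),
    where rho(P) is the number of roots of f mod P. It is obtained without
    ideal theory by averaging the resultants Res(f, x) over the polynomials
    x = Q_0 + ... + Q_(d-1) X^(d-1) with deg Q_i < m: such a resultant is
    nonzero for x != 0, has degree at most d m + O(1), and is divisible by P^k
    as soon as f and x have k common roots mod P; by counting dimensions, a
    given root mod P is a root of x for a proportion at least 1/|P| of the x.
    Higher powers of P contribute O(q^n): away from finitely many P, a root of
    f mod P lifts to at most one root mod P^k or, when f is inseparable in X,
    f(Q) is never divisible by P^2, by differentiation in T; at the remaining P
    a Vandermonde determinant shows that the roots of f mod P^k lie in at most
    d classes modulo a power of P growing with k.

    Hence large primes carry at least (d-1) n q^n - O(q^n). A large P divides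
    f(Q) for at most d of the Q, so at least 1/d of its contribution survives
    in the lcm, which is (i). If it did so for exactly d of them, Q_1, ...,
    Q_d, then f = f_d (X - Q_1) ... (X - Q_d) mod P, hence P would divide
    f_d (Q_1 + ... + Q_d) + f_(d-1), whose degree is less than deg P and which
    is nonzero under the assumption of (ii); so 1/d improves to 1/(d-1). *)

Set Implicit Arguments.
Unset Strict Implicit.
Unset Printing Implicit Defensive.

Import Order.TTheory GRing.Theory Num.Theory.

Local Open Scope ring_scope.

(** A downward closed predicate holds on an initial segment, so counting it amounts to finding where
    it stops. This turns the counting definition of [vp] into divisibility by powers. *)
Lemma sum_downward (b : nat -> bool) (n j : nat) :
  (forall k, b k.+1 -> b k) ->
  (j < \sum_(k < n) b k)%N = (j < n)%N && b j.
Proof.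
move=> bS; have bW i k : (i <= k)%N -> b k -> b i.
  by move=> /subnK <-; elim: (k - i)%N => // m IH; rewrite addSn => /bS.
elim: n => [|n IH]; first by rewrite big_ord0.
rewrite big_ord_recr /=.
case bn: (b n); last first.
  rewrite addn0 IH ltnS [in RHS]leq_eqVlt.
  by case: eqVneq => [->|_] //=; rewrite ltnn bn.
have -> : (\sum_(k < n) b k = n)%N.
  rewrite -[RHS]card_ord -sum1_card; apply: eq_bigr => k _.
  by rewrite (bW _ n) // ltnW.
rewrite addn1 ltnS; case: (leqP j n) => //= jn.
by rewrite (bW _ n).
Qed.

(** * Valuations and primes of F[T] *)

Section Valuation.
Variable F : finFieldType.
Implicit Types (P a b : {poly F}).

Definition is_prime P := (P \is monic) && irreducibleb P.

Lemma is_primeP P : reflect (monic_irreducible_poly P) (is_prime P).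
Proof.
apply: (iffP andP) => [[mP /irreducibleP iP]|[iP mP]]; first by split.
by split=> //; apply/irreducibleP.
Qed.

Lemma prime_irr P : is_prime P -> irreducible_poly P.
Proof. by move=> /is_primeP []. Qed.

Lemma prime_monic P : is_prime P -> P \is monic.
Proof. by case/andP. Qed.

Lemma prime_neq0 P : is_prime P -> P != 0.
Proof. by move=> /prime_monic /monic_neq0. Qed.

Lemma prime_deg_gt0 P : is_prime P -> (0 < deg P)%N.
Proof. by move=> /prime_irr [sP _]; rewrite /deg -subn1 subn_gt0. Qed.

Lemma size_deg a : a != 0 -> size a = (deg a).+1.
Proof. by move=> a0; rewrite /deg -polySpred. Qed.

Lemma degM a b : a != 0 -> b != 0 -> deg (a * b) = (deg a + deg b)%N.
Proof. by move=> a0 b0; rewrite {1}/deg size_mul // !size_deg // addnS. Qed.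

Lemma degX a k : a != 0 -> deg (a ^+ k) = (k * deg a)%N.
Proof.
move=> a0; elim: k => [|k IH]; first by rewrite expr0 /deg size_poly1.
by rewrite exprS degM ?expf_neq0 // IH mulSn.
Qed.

Lemma deg_dvdp a b : a %| b -> b != 0 -> (deg a <= deg b)%N.
Proof. by move=> ab b0; rewrite /deg -!subn1 leq_sub2r // dvdp_leq. Qed.

Lemma prime_coprimep P a : is_prime P -> coprimep P a = ~~ (P %| a).
Proof. by move=> /prime_irr /irreducible_poly_coprime. Qed.

Lemma prime_dvdM P a b : is_prime P -> (P %| a * b) = (P %| a) || (P %| b).
Proof.
move=> pP; have [Pa|nPa] := boolP (P %| a); first by rewrite dvdp_mulr.
by rewrite Gauss_dvdpr // prime_coprimep.
Qed.

Lemma prime_dvd_prod P (I : Type) (r : seq I) (Q : pred I) (G : I -> {poly F}) :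
  is_prime P -> P %| \prod_(i <- r | Q i) G i ->
  has (fun i => Q i && (P %| G i)) r.
Proof.
move=> pP; elim: r => [|i r IH].
  rewrite big_nil dvdp1; have [sP _] := prime_irr pP.
  by rewrite eqn_leq leqNgt sP.
rewrite big_cons /=; case: (Q i) => //=.
by rewrite prime_dvdM // => /orP[->//|/IH ->]; rewrite orbT.
Qed.

Lemma prime_dvd_eq P P' : is_prime P -> is_prime P' -> P %| P' -> P = P'.
Proof.
move=> pP pP' PP'; apply/eqP; rewrite -eqp_monic ?prime_monic //.
have [_ irr] := prime_irr pP'; apply: irr => //.
by have [sP _] := prime_irr pP; rewrite neq_ltn sP orbT.
Qed.

Lemma exists_prime_dvd a : a != 0 -> (0 < deg a)%N ->
  exists2 P, is_prime P & P %| a.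
Proof.
move: {2}(deg a) (leqnn (deg a)) => n; elim: n a => [|n IH] a; first by lia.
move=> an a0 da; have [/irreducibleP ia|nia] := boolP (irreducibleb a).
  exists ((lead_coef a)^-1 *: a);
    last by rewrite dvdpZl ?invr_eq0 ?lead_coef_eq0.
  have lc0 : lead_coef a != 0 by rewrite lead_coef_eq0.
  apply/is_primeP; split; last by rewrite monicE lead_coefZ mulVf.
  split=> [|b sb]; first by rewrite size_scale ?invr_eq0 //; case: ia.
  rewrite dvdpZr ?invr_eq0 // => /ia -/(_ sb) ba.
  by rewrite (eqp_trans ba) // eqp_sym eqp_scale ?invr_eq0.
(* [irreducibleb] only tests divisors of degree less than [deg a], so its failure yields a divisor
   [b] with [0 < deg b < deg a], to which the induction applies. *)
move: nia; rewrite /irreducibleb negb_and size_deg // ltnS da /=.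
rewrite negb_forall => /existsP[/= b]; rewrite negb_imply => /andP[].
rewrite -Pdiv.Idomain.dvdpE -ltnNge => ba sb.
have b0 : val b != 0 by rewrite -size_poly_gt0; apply: leq_trans sb.
have [||P pP Pb] := IH (val b) _ b0.
- have sb' := size_npoly b; rewrite size_deg // in sb'.
  by rewrite -ltnS; apply: leq_trans sb' _.
- by move: sb; rewrite size_deg.
by exists P => //; apply: dvdp_trans ba.
Qed.

(* The multiplicity of P in a; junk value 0 at a = 0. *)
Definition vp P a : nat := (\sum_(k < size a) (P ^+ k.+1 %| a)%R)%N.

Lemma vp_gtE P a k : a != 0 -> is_prime P -> (k < vp P a)%N = (P ^+ k.+1 %| a).
Proof.
move=> a0 pP.
have sd j : P ^+ j.+2 %| a -> P ^+ j.+1 %| a.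
  by apply: dvdp_trans; rewrite dvdp_exp2l.
apply: etrans (@sum_downward (fun j => P ^+ j.+1 %| a) _ _ sd) _.
apply/andP/idP => [[]//|Pa]; split=> //.
have := deg_dvdp Pa a0; rewrite degX ?prime_neq0 // size_deg //.
have := prime_deg_gt0 pP; nia.
Qed.

Lemma vp_geE P a k : a != 0 -> is_prime P -> (k <= vp P a)%N = (P ^+ k %| a).
Proof. by case: k => [|k] a0 pP; rewrite ?dvd1p // vp_gtE. Qed.

Lemma dvdp_vp P a : a != 0 -> is_prime P -> P ^+ vp P a %| a.
Proof. by move=> a0 pP; rewrite -vp_geE. Qed.

Lemma vp_mul_deg P a : a != 0 -> is_prime P -> (vp P a * deg P <= deg a)%N.
Proof.
by move=> a0 pP; rewrite -degX ?prime_neq0 // deg_dvdp // dvdp_vp.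
Qed.

(** By degrees, no power beyond [P ^+ K] divides [a]. A truncation point independent of [a] lets the
    sums over powers and over values be exchanged later. *)
Lemma vp_sum P a K : a != 0 -> is_prime P -> (deg a <= K * deg P)%N ->
  vp P a = (\sum_(k < K) (P ^+ k.+1 %| a)%R)%N.
Proof.
move=> a0 pP aK; apply/eqP; rewrite eqn_leq; apply/andP.
have sd k : P ^+ k.+2 %| a -> P ^+ k.+1 %| a.
  by apply: dvdp_trans; rewrite dvdp_exp2l.
have vK : (vp P a <= K)%N.
  have := vp_mul_deg a0 pP; have := prime_deg_gt0 pP; nia.
split.
  move: (vp_geE (vp P a) a0 pP); rewrite leqnn.
  case E : (vp P a) vK => [//|v] vK /esym Pa.
  by apply: etrans (@sum_downward (fun j => P ^+ j.+1 %| a) _ _ sd) _;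
    rewrite vK.
rewrite leqNgt; apply/negP.
move=> /(etrans (esym (@sum_downward (fun j => P ^+ j.+1 %| a) _ _ sd))).
move=> /andP[_].
by rewrite -vp_gtE // ltnn.
Qed.

Lemma vp_dvd P a b : a %| b -> b != 0 -> is_prime P -> (vp P a <= vp P b)%N.
Proof.
move=> ab b0 pP; rewrite vp_geE //; apply: dvdp_trans (ab);
  apply: dvdp_vp => //.
by apply: contraNneq b0 => a0; move: ab; rewrite a0 dvd0p.
Qed.

(** Powers of distinct primes are coprime, so their product still divides [a]. *)
Lemma sum_deg_vp_le (s : seq {poly F}) (a : {poly F}) :
  uniq s -> all is_prime s -> a != 0 ->
  (\sum_(P <- s) deg P * vp P a <= deg a)%N.
Proof.
move=> us ps a0.
have [dv dg] : (\prod_(P <- s) P ^+ vp P a %| a) /\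
    deg (\prod_(P <- s) P ^+ vp P a) = (\sum_(P <- s) deg P * vp P a)%N.
  elim: s us ps => [|P s IH] /=;
    first by rewrite !big_nil dvd1p /deg size_poly1.
  move=> /andP[Ps us] /andP[pP ps]; have [dv dg] := IH us ps.
  have n0 : \prod_(P <- s) P ^+ vp P a != 0.
    by apply: contraNneq a0 => h; move: dv; rewrite h dvd0p.
  have P0 := prime_neq0 pP.
  rewrite !big_cons (degM (expf_neq0 _ P0) n0) (degX _ P0) dg mulnC.
  split=> //; rewrite Gauss_dvdp ?dvdp_vp // coprimep_expl // prime_coprimep //.
  apply/negP => /(prime_dvd_prod pP) /hasP[P' P's] /=.
  have pP' := allP ps _ P's.
  case: (vp P' a) => [|v]; first by rewrite expr0 dvdp1;
    have [] := prime_irr pP; lia.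
  move=> h; have {h} : P %| P'.
    elim: v h => [|v IHv]; first by rewrite expr1.
    by rewrite exprS prime_dvdM // => /orP[].
  by move=> /(prime_dvd_eq pP pP') PP'; move: Ps; rewrite PP' P's.
by rewrite -dg; apply: deg_dvdp.
Qed.

Definition primes_deg m := [seq P <- monics F m | is_prime P].

Lemma mem_primes_deg m P : (P \in primes_deg m) = is_prime P && (deg P == m).
Proof.
rewrite mem_filter mem_monics; have [pP|//] := boolP (is_prime P).
by rewrite prime_monic // size_deg ?prime_neq0.
Qed.

Definition primes_upto N := flatten [seq primes_deg m | m <- iota 0 N.+1].

Lemma mem_primes_upto N P :
  (P \in primes_upto N) = is_prime P && (deg P <= N)%N.
Proof.
apply/flatten_mapP/andP => [[m]|[pP dP]].
  by rewrite mem_iota mem_primes_deg => /andP[_ mN] /andP[-> /eqP ->].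
by exists (deg P); rewrite ?mem_iota ?mem_primes_deg ?pP ?eqxx.
Qed.

Lemma uniq_primes_upto N : uniq (primes_upto N).
Proof.
rewrite /primes_upto; elim: N.+1 => // M IH.
rewrite -addn1 iotaD map_cat flatten_cat cat_uniq IH /= cats0 add0n.
rewrite filter_uniq ?uniq_monics // andbT.
apply/hasPn => P; rewrite mem_primes_deg => /andP[pP /eqP dP].
apply/negP => /flatten_mapP[m]; rewrite mem_iota mem_primes_deg.
by move=> /andP[_ mM] /andP[_ /eqP]; lia.
Qed.

Lemma all_primes_upto N : all is_prime (primes_upto N).
Proof. by apply/allP => P; rewrite mem_primes_upto => /andP[]. Qed.

Lemma sum_primes_upto N (G : {poly F} -> nat) :
  (\sum_(P <- primes_upto N) G P =
   \sum_(m < N.+1) \sum_(P <- primes_deg m) G P)%N.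
Proof.
rewrite /primes_upto big_flatten big_map -[N.+1 in LHS]subn0.
by rewrite -/(index_iota _ _) big_mkord.
Qed.

(** Prime factors are removed one at a time: in [a = b * P] the factor [P] raises [vp P] by at least
    one, and the degree bound [N] puts [P] in the list. *)
Lemma deg_le_sum_vp (a : {poly F}) N : a != 0 -> (deg a <= N)%N ->
  (deg a <= \sum_(P <- primes_upto N) deg P * vp P a)%N.
Proof.
move: {2}(deg a) (leqnn (deg a)) => n; elim: n a => [|n IH] a; first by lia.
move=> an a0 aN; have [->//|da] := posnP (deg a).
have [P pP Pa] := exists_prime_dvd a0 da.
have Ea : a = (a %/ P) * P by rewrite divpK.
set b := a %/ P in Ea; clearbody b.
have b0 : b != 0 by apply: contraNneq a0 => h; rewrite Ea h mul0r.
have dab : deg a = (deg b + deg P)%N by rewrite Ea (degM b0 (prime_neq0 pP)).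
have P_gt0 := prime_deg_gt0 pP.
have bn : (deg b <= n)%N by lia.
have bN : (deg b <= N)%N by lia.
have IHb := IH b bn b0 bN.
have PN : P \in primes_upto N by rewrite mem_primes_upto pP /=; lia.
rewrite (big_rem P) //= in IHb; rewrite [leqRHS](big_rem P) //= dab.
have vP : ((vp P b).+1 <= vp P a)%N.
  rewrite vp_geE // exprSr Ea dvdp_mul2r ?prime_neq0 //; exact: dvdp_vp.
have vle : (\sum_(y <- rem P (primes_upto N)) deg y * vp y b <=
   \sum_(y <- rem P (primes_upto N)) deg y * vp y a)%N.
  rewrite big_seq [leqRHS]big_seq; apply: leq_sum => y yP.
  rewrite leq_mul2l vp_dvd ?orbT //; first by rewrite Ea dvdp_mulr.
  by have := mem_rem yP; rewrite mem_primes_upto => /andP[].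
apply: leq_trans (leq_add IHb (leqnn (deg P))) _; rewrite addnAC.
by apply: leq_add _ vle; rewrite -mulnSr leq_mul2l vP orbT.
Qed.

(** Each such [P] divides ['X^(#|F| ^ m) - 'X], because the quotient by [P] is a field with
    [#|F| ^ m] elements. *)
Lemma sum_deg_primes_deg m : (\sum_(P <- primes_deg m) deg P <= #|F| ^ m)%N.
Proof.
have [->|m0] := posnP m.
  rewrite big_seq big1 // => P; rewrite mem_primes_deg => /andP[_ /eqP //].
have qm1 : (1 < #|F| ^ m)%N.
  by rewrite -[ltnLHS](expn0 #|F|) ltn_exp2l // finNzRing_gt1.
have sG : size ('X^(#|F| ^ m) - 'X : {poly F}) = (#|F| ^ m).+1.
  by rewrite size_polyDl ?size_polyXn // size_polyN size_polyX.
have G0 : ('X^(#|F| ^ m) - 'X : {poly F}) != 0 by rewrite -size_poly_gt0 sG.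
have us : uniq (primes_deg m) by rewrite filter_uniq ?uniq_monics.
have ps : all is_prime (primes_deg m).
  by apply/allP => P; rewrite mem_primes_deg => /andP[].
have := sum_deg_vp_le us ps G0; rewrite {2}/deg sG /=.
apply: leq_trans; rewrite big_seq [leqRHS]big_seq; apply: leq_sum => P.
rewrite mem_primes_deg => /andP[pP /eqP dP].
rewrite -[leqLHS]muln1 leq_mul2l; apply/orP; right.
rewrite vp_geE // expr1.
have /is_primeP hI := pP.
have cQ : #|{poly %/ P with hI}| = (#|F| ^ m)%N.
  by rewrite card_npoly mk_monicE // -/(deg P) dP.
have E := expf_card (in_qpoly P 'X : {poly %/ P with hI}); rewrite cQ in E.
have {E} : in_qpoly P ('X^(#|F| ^ m) - 'X) = 0.
  by rewrite rmorphB rmorphXn /=; apply/eqP; rewrite subr_eq0; apply/eqP;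
    exact: E.
move=> /(congr1 val) /=; rewrite mk_monicE // => h.
by rewrite Pdiv.Idomain.dvdpE /Pdiv.Ring.rdvdp h.
Qed.

End Valuation.

(** * Irreducibility over F(T) and good primes *)

Lemma horner_taylor2 (A : comNzRingType) (f : {poly A}) (x h : A) :
  exists w, f.[x + h] = f.[x] + f^`().[x] * h + h ^+ 2 * w.
Proof.
elim/poly_ind: f => [|f c [w IH]]; first by exists 0; rewrite deriv0 !hornerE;
  ring.
exists (w * (x + h) + f^`().[x]).
by rewrite !hornerMXaddC derivMXaddC hornerD hornerMX IH; ring.
Qed.

(** Chain rule in T: the first term differentiates the coefficients, the second the argument. *)
Lemma deriv_horner (A : comNzRingType) (f : {poly {poly A}}) (Q : {poly A}) :
  (f.[Q])^`() = (map_poly (@deriv A) f).[Q] + f^`().[Q] * Q^`().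
Proof.
elim/poly_ind: f => [|f c IH];
  first by rewrite map_poly0 deriv0 !hornerE deriv0; ring.
have -> : map_poly (@deriv A) (f * 'X + c%:P) =
    map_poly (@deriv A) f * 'X + (c^`())%:P.
  apply/polyP => i; rewrite coef_map !coefD !coefMX !coefC coef_map /=.
  by case: i => [|i] /=; rewrite ?add0r ?addr0.
by rewrite !hornerMXaddC derivMXaddC hornerD hornerMX derivD derivM IH; ring.
Qed.

(** A zero derivative leaves only exponents divisible by [p]; since Frobenius is additive, a root
    can then be taken coefficient by coefficient. *)
Lemma pth_power_poly (A : idomainType) (p : nat) (g : {poly A}) :
  p \in [pchar A] -> g^`() = 0 -> (forall i, exists b, b ^+ p == g`_i) ->
  exists h, h ^+ p = g.
Proof.
move=> pA g'0 rt; have pr_p := pcharf_prime pA.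
have pP : p \in [pchar {poly A}] by rewrite pchar_poly.
pose b i := xchoose (rt (i * p)%N).
have bE i : b i ^+ p = g`_(i * p) by apply/eqP/(xchooseP (rt (i * p)%N)).
exists (\sum_(i < size g) (b i)%:P * 'X^i).
rewrite -(pFrobenius_autE pP) rmorph_sum /=.
under eq_bigr => i _ do rewrite pFrobenius_autE exprMn -exprM -rmorphXn bE /=.
apply/polyP => j; rewrite coef_sum.
under eq_bigr => i _ do rewrite coefCM coefXn.
have [/dvdnP[i ->]|npj] := boolP (p %| j)%N.
  have [ig|ig] := ltnP i (size g).
    rewrite (bigD1 (Ordinal ig)) //= eqxx mulr1 big1 ?addr0 // => k ki.
    rewrite eqn_pmul2r ?prime_gt0 // [i == k]eq_sym.
    by rewrite -val_eqE /= in ki; rewrite (negPf ki) mulr0.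
  rewrite nth_default; last by rewrite (leq_trans ig) // leq_pmulr // prime_gt0.
  rewrite big1 // => k _; rewrite eqn_pmul2r ?prime_gt0 //.
  by rewrite gtn_eqF ?mulr0 // (leq_trans (ltn_ord k)).
rewrite big1 => [|k _]; last first.
  case: eqP => [E|]; last by rewrite mulr0.
  by rewrite E dvdn_mull in npj.
case: j npj => [|j npj]; first by rewrite dvdn0.
have := congr1 (fun u : {poly A} => u`_j) g'0; rewrite coef_deriv coef0 => /eqP.
rewrite -mulr_natr mulf_eq0 => /orP[/eqP -> //|].
by rewrite -(dvdn_pcharf pA) (negPf npj).
Qed.

Section Irreducible.
Variable F : finFieldType.
Implicit Types (P Q : {poly F}) (f g h x : {poly {poly F}}).

(** If [i] and [j] are the least indices of coefficients of [g] and [h] not divisible by [P], the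
    coefficient of index [i + j] of [g * h] is the product of these two modulo [P]. *)
Lemma prime_dvd_coefM P g h : is_prime P -> (forall i, P %| (g * h)`_i) ->
  (forall i, P %| g`_i) \/ (forall i, P %| h`_i).
Proof.
move=> pP Pgh.
have all_or_min (u : {poly {poly F}}) : (forall i, P %| u`_i) \/
    exists i, ~~ (P %| u`_i) /\ forall j, (j < i)%N -> P %| u`_j.
  have [/allP al|/allPn[i _ ni]] :=
    boolP (all (fun i => P %| u`_i) (iota 0 (size u))).
    left=> i; have [iu|iu] := ltnP i (size u);
      last by rewrite nth_default ?dvdp0.
    by apply: al; rewrite mem_iota.
  right; have ex : exists i, ~~ (P %| u`_i) by exists i.
  case: (ex_minnP ex) => j nj mj; exists j; split=> // k kj.
  by apply/negPn/negP => /mj; rewrite leqNgt kj.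
have [|[i [ni mi]]] := all_or_min g; first by left.
have [|[j [nj mj]]] := all_or_min h; first by right.
have := Pgh (i + j)%N; rewrite coefM.
have li : (i < (i + j).+1)%N by lia.
rewrite (bigD1 (Ordinal li)) //= addKn dvdp_addl.
  by rewrite prime_dvdM // (negPf ni) (negPf nj).
apply: (big_ind (fun y => P %| y)) => [|y z|k]; first exact: dvdp0.
  exact: dvdp_add.
rewrite -val_eqE /= => ki.
have [lki|lik] := ltnP k i; first by rewrite dvdp_mulr // mi.
by rewrite dvdp_mull // mj; have := ltn_ord k; lia.
Qed.

Lemma coef_dvd_scale P g : (forall i, P %| g`_i) ->
  exists g', g = P *: g'.
Proof.
move=> Pg; exists (\poly_(i < size g) (g`_i %/ P)).
apply/polyP => i; rewrite coefZ coef_poly; case: ltnP => ig.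
  by rewrite mulrC divpK.
by rewrite mulr0 nth_default.
Qed.

(* Gauss's lemma. *)
Lemma irreducible_scale f c g h :
  ring_irreducible f -> c != 0 -> c *: f = g * h ->
  (size g <= 1)%N \/ (size h <= 1)%N.
Proof.
move=> [_ _ irr]; move: {2}(deg c) (leqnn (deg c)) => n.
elim: n c g h => [|n IH] c g h cn c0 E.
  have [k k0 Ec] : exists2 k : F, k != 0 & c = k%:P.
    have sc : (size c <= 1)%N by rewrite size_deg.
    exists c`_0; last exact: size1_polyC.
    by apply: contraNneq c0 => h0; rewrite (size1_polyC sc) h0.
  have kP0 : (k^-1)%:P != 0 :> {poly F} by rewrite polyC_eq0 invr_eq0.
  have /irr : f = ((k^-1)%:P *: g) * h.
    by rewrite -scalerAl -E scalerA Ec -rmorphM mulVf //= scale1r.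
  rewrite !poly_unitE size_scale // => -[/andP[/eqP -> _]|/andP[/eqP -> _]];
  by [left|right].
have [|dc] := leqP (deg c) 0; first by move=> dc; apply: IH E => //; lia.
have [P pP /dvdpP[c' Ec]] := exists_prime_dvd c0 dc.
have P0 := prime_neq0 pP.
have c'0 : c' != 0 by apply: contraNneq c0 => h0; rewrite Ec h0 mul0r.
have c'n : (deg c' <= n)%N.
  by move: cn; rewrite Ec (degM c'0 P0); have := prime_deg_gt0 pP; lia.
have PP0 : P%:P != 0 :> {poly {poly F}} by rewrite polyC_eq0.
have : forall i, P %| (g * h)`_i.
  by move=> i; rewrite -E coefZ Ec -mulrA dvdp_mull // dvdp_mulr.
move=> /(prime_dvd_coefM pP)[] /coef_dvd_scale[u Eu].
  suff /IH : c' *: f = u * h by rewrite Eu size_scale //; apply.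
  by apply: (mulfI PP0); rewrite !mul_polyC scalerA mulrC -Ec E Eu -scalerAl.
suff /IH : c' *: f = g * u by rewrite Eu size_scale //; apply.
by apply: (mulfI PP0); rewrite !mul_polyC scalerA mulrC -Ec E Eu -scalerAr.
Qed.

(** Otherwise [gcdp f x] has positive degree in X; by Gauss's lemma its cofactor in [f] is constant,
    so it has the degree of [f], more than [x] allows. *)
Lemma irreducible_resultant_neq0 f x : ring_irreducible f -> x != 0 ->
  (size x < size f)%N -> resultant f x != 0.
Proof.
move=> irr x0 sx; rewrite resultant_eq0 -leqNgt.
have /Pdiv.WeakIdomain.dvdpP[[/= c u] c0 E] := dvdp_gcdl f x.
have [su|//] := irreducible_scale irr c0 E.
have f0 : f != 0 by case: irr.
have gx : (size (gcdp f x) <= size x)%N by rewrite dvdp_leq // dvdp_gcdr.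
have u0 : u != 0.
  apply: contraNneq f0 => u0; move/eqP: E; rewrite u0 mul0r scale_poly_eq0.
  by rewrite (negPf c0).
have g0 : gcdp f x != 0 by rewrite gcdp_eq0 (negPf f0).
have Es : size f = (size u + size (gcdp f x)).-1.
  by rewrite -(size_mul u0 g0) -E size_scale.
have suf : (size f <= size (gcdp f x))%N.
  by rewrite Es; case: (size u) su => [|[|//]] _; rewrite ?add0n ?leq_pred.
by have := leq_trans sx (leq_trans suf gx); rewrite ltnn.
Qed.

(** The resultant lies in the ideal generated by [f] and [x], so it can serve as [r]; for [x]
    constant in X, [x] itself does. *)
Lemma irreducible_common_root f x : ring_irreducible f -> x != 0 ->
  (size x < size f)%N -> exists2 r, r != 0 &
  forall P Q, P %| f.[Q] -> P %| x.[Q] -> P %| r.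
Proof.
move=> irr x0 sx; have [sx1|sx1] := leqP (size x) 1.
  exists x`_0.
    by apply: contraNneq x0 => h0; rewrite (size1_polyC sx1) h0.
  by move=> P Q _; rewrite {1}(size1_polyC sx1) hornerC.
exists (resultant f x) => [|P Q Pf Px]; first exact: irreducible_resultant_neq0.
have [[u v] _ /(congr1 (fun r => r.[Q]))] :=
  resultant_in_ideal (ltn_trans sx1 sx) sx1.
by rewrite hornerC hornerD !hornerM => ->; rewrite dvdp_add // dvdp_mull.
Qed.

Lemma irreducible_horner_neq0 f Q : ring_irreducible f -> (2 < size f)%N ->
  f.[Q] != 0.
Proof.
move=> irr sf; apply/negP => /factor_theorem[g E].
have : 1 *: f = g * ('X - Q%:P) by rewrite scale1r.
move=> /(irreducible_scale irr (oner_neq0 _)); rewrite size_XsubC => -[sg|//].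
have g0 : g != 0 by apply: contraTneq sf => g0; rewrite E g0 mul0r size_poly0.
move: sf; rewrite E size_Mmonic ?monicXsubC ?size_XsubC //.
by case: (size g) sg => [|[|]].
Qed.

(* Otherwise f would be a p-th power up to a factor in F[T]. *)
Lemma irreducible_insep f : ring_irreducible f -> (2 < size f)%N -> f^`() = 0 ->
  lead_coef f *: map_poly (@deriv F) f - (lead_coef f)^`() *: f != 0.
Proof.
move=> irr sf f'0; apply/negP => /eqP x0.
have [p pr_p pF] := finPcharP F.
have p_gt1 := prime_gt1 pr_p.
set c := lead_coef f in x0.
have f0 : f != 0 by case: irr.
have c0 : c != 0 by rewrite lead_coef_eq0.
have pPF : p \in [pchar {poly F}] by rewrite pchar_poly.
have xi i : c * (f`_i)^`() = c^`() * f`_i.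
  have := congr1 (fun u : {poly {poly F}} => u`_i) x0.
  rewrite coefB !coefZ coef_map coef0 /= => /eqP; rewrite subr_eq0 => /eqP //.
(* By [xi], the T-derivative of each coefficient of [c ^+ p.-1 *: f] is a multiple of [p], hence
   zero. Frobenius being bijective on [F], these coefficients are p-th powers. *)
have [h Eh] : exists h, h ^+ p = c ^+ p.-1 *: f.
  apply: pth_power_poly => //; first by rewrite derivZ f'0 scaler0.
  move=> i; suff [b <-] : exists b, b ^+ p = (c ^+ p.-1 *: f)`_i by exists b.
  apply: pth_power_poly => // [|j]; last first.
    have inj : injective (pFrobenius_aut pF) by apply: fmorph_inj.
    by exists (invF inj (c ^+ p.-1 *: f)`_i`_j);
      rewrite -pFrobenius_autE f_invF.
  rewrite coefZ derivM deriv_exp.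
  have -> : p.-1 = p.-2.+1 by lia.
  rewrite /= exprSr -mulrA xi.
  have -> : c^`() * c ^+ p.-2 *+ p.-2.+1 * f`_i + c ^+ p.-2 * (c^`() * f`_i) =
      (c ^+ p.-2 * c^`() * f`_i) *+ p by rewrite -[in RHS](ltn_predK p_gt1);
        case: p p_gt1 {pr_p pF pPF} => [|[|p]] //= _; ring.
  by rewrite -mulr_natr (pcharf0 pPF) mulr0.
have cp0 : c ^+ p.-1 != 0 by rewrite expf_neq0.
(* By Gauss's lemma [h] or [h ^+ p.-1] is constant in X. Either way [h] is, and then so is [f],
   against [2 < size f]. *)
have sh : (size h <= 1)%N.
  have : c ^+ p.-1 *: f = h * h ^+ p.-1 by rewrite -Eh -exprS prednK // ltnW.
  move=> /(irreducible_scale irr cp0) [//|sh].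
  have E0 : ((size h).-1 * p.-1 = 0)%N.
    by rewrite -size_exp; case: (size _) sh => [|[|]].
  move/eqP: E0; rewrite muln_eq0 -!subn1 !subn_eq0 => /orP[//|].
  by rewrite leqNgt p_gt1.
move: sf; rewrite -(size_scale _ cp0) -Eh (size1_polyC sh) -rmorphXn size_polyC.
by case: (_ != _).
Qed.

(** [D] is [lead_coef f] times an [r] obtained by eliminating X between [f] and a polynomial of
    smaller degree: its X-derivative if nonzero, else a combination of [f] with its T-derivative. *)
Lemma good_modulus f : ring_irreducible f -> (2 < size f)%N ->
  exists2 D, D != 0 & (lead_coef f %| D) /\
  forall P, is_prime P -> ~~ (P %| D) -> forall k Q Q',
    P ^+ k %| f.[Q] -> P ^+ k %| f.[Q'] -> P %| Q' - Q -> P ^+ k %| Q' - Q.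
Proof.
move=> irr sf; have f0 : f != 0 by case: irr.
have c0 : lead_coef f != 0 by rewrite lead_coef_eq0.
have [f'0|f'0] := eqVneq f^`() 0.
  (* The top coefficients of the two terms cancel. *)
  have sx : (size (lead_coef f *: map_poly (@deriv F) f -
                   (lead_coef f)^`() *: f)%R < size f)%N.
    rewrite (polySpred f0) ltnS; apply/leq_sizeP => j.
    rewrite coefB !coefZ coef_map /= leq_eqVlt => /orP[/eqP <-|].
      by rewrite -lead_coefE mulrC subrr.
    by rewrite -(polySpred f0) => jf;
      rewrite nth_default // deriv0 !mulr0 subrr.
  have [r r0 hr] :=
    irreducible_common_root irr (irreducible_insep irr sf f'0) sx.
  exists (lead_coef f * r); first by rewrite mulf_neq0.
  split=> [|P pP]; first exact: dvdp_mulr.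
  (* Exponents 0 and 1 are immediate. From 2 on the hypothesis is contradictory: [P] would divide
     the T-derivative of [f.[Q]], to which only the coefficients of [f] contribute, and hence
     [r]. *)
  rewrite prime_dvdM // negb_or => /andP[_ nr] [|[|k]] Q Q'.
  - by move=> _ _ _; rewrite expr0 dvd1p.
  - by rewrite expr1.
  move=> Pf _ _; case/negP: nr; apply: (hr P Q).
    by apply: dvdp_trans Pf; rewrite exprS dvdp_mulr.
  rewrite hornerD hornerN !hornerZ dvdp_sub //; last first.
    by rewrite dvdp_mull //; apply: dvdp_trans Pf; rewrite exprS dvdp_mulr.
  have /dvdpP[u Eu] : P ^+ 2 %| f.[Q] by apply: dvdp_trans Pf;
    rewrite dvdp_exp2l.
  have := deriv_horner f Q; rewrite f'0 horner0 mul0r addr0 => <-.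
  rewrite dvdp_mull // Eu derivM dvdp_add // ?dvdp_mull //.
  by rewrite deriv_exp expr1 -mulrnAl dvdp_mull.
have sx : (size f^`() < size f)%N by rewrite lt_size_deriv.
have [r r0 hr] := irreducible_common_root irr f'0 sx.
exists (lead_coef f * r); first by rewrite mulf_neq0.
split=> [|P pP]; first exact: dvdp_mulr.
rewrite prime_dvdM // negb_or => /andP[_ nr] [|k] Q Q' Pf Pf' PQ.
  by rewrite expr0 dvd1p.
have Pf1 : P %| f.[Q] by apply: dvdp_trans Pf; rewrite exprS dvdp_mulr.
have nf' : ~~ (P %| f^`().[Q]) by apply: contra nr; apply: hr.
have [w Ew] := horner_taylor2 f Q (Q' - Q).
have EQ : Q + (Q' - Q) = Q' by rewrite addrC subrK.
(* Uniqueness in Hensel's lemma: modulo [P] the cofactor is the X-derivative at [Q], which is prime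
   to [P], so it can be cancelled. *)
have : P ^+ k.+1 %| (Q' - Q) * (f^`().[Q] + (Q' - Q) * w).
  have -> : (Q' - Q) * (f^`().[Q] + (Q' - Q) * w) = f.[Q'] - f.[Q].
    by rewrite EQ in Ew; rewrite Ew; ring.
  by rewrite dvdp_sub.
rewrite Gauss_dvdpl // coprimep_expl // prime_coprimep // dvdp_addl //.
exact: dvdp_mulr.
Qed.

End Irreducible.

(** * Vandermonde and Sylvester determinants *)

Section Determinants.
Variable F : finFieldType.
Implicit Types (P a : {poly F}) (f g x : {poly {poly F}}).

Lemma dvdp_sum (I : finType) (A : pred I) a (G : I -> {poly F}) :
  (forall i, A i -> a %| G i) -> a %| \sum_(i | A i) G i.
Proof.
by move=> aG; apply: (big_ind (fun y => a %| y)) => [|y z|];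
  [exact: dvdp0|exact: dvdp_add|].
Qed.

(** The coefficient row of [g] times the Vandermonde matrix is the row of values; the adjugate then
    writes determinant times coefficient as a combination of values. *)
Lemma vandermonde_dvd N a g (s : 'I_N.+1 -> {poly F}) :
  (size g <= N.+1)%N -> (forall i, a %| g.[s i]) ->
  a %| g`_N * \prod_(i < N.+1) \prod_(j < N.+1 | (i < j)%N) (s j - s i).
Proof.
move=> sg ag; pose V := Vandermonde N.+1 (\row_j s j).
have -> : \prod_(i < N.+1) \prod_(j < N.+1 | (i < j)%N) (s j - s i) = \det V.
  rewrite det_Vandermonde; apply: eq_bigr => i _; apply: eq_bigr => j _.
  by rewrite !mxE.
pose c := \row_(i < N.+1) g`_i.
have cV : c *m V = \row_j g.[s j].
  apply/rowP => j; rewrite !mxE (horner_coef_wide _ sg).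
  by apply: eq_bigr => i _; rewrite !mxE.
have /(congr1 (fun u : 'rV_N.+1 => u 0 ord_max)) :
    c *m V *m \adj V = \det V *: c.
  by rewrite -mulmxA mul_mx_adj mul_mx_scalar.
rewrite cV !mxE /= mulrC => <-; apply: dvdp_sum => j _.
by rewrite mxE dvdp_mulr.
Qed.

(** Modulo [P], [M] kills the [k] vectors of powers of the [r j]. Putting them in place of the first
    [k] columns of the identity multiplies the determinant by a Vandermonde determinant prime to
    [P], and makes [k] columns divisible by [P]. *)
Lemma det_dvd_exp P k l (M : 'M[{poly F}]_(k + l)) (r : 'I_k -> {poly F}) :
  is_prime P -> (forall i j, i != j -> ~~ (P %| r j - r i)) ->
  (forall i j, P %| \sum_t M i t * r j ^+ t) -> P ^+ k %| \det M.
Proof.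
move=> pP rP MP; pose U := Vandermonde (k + l) (\row_j r j).
pose B := \matrix_(i < k + l, j < k) ((\sum_t M i t * r j ^+ t) %/ P).
have MU : M *m U = B *m P%:M.
  rewrite mul_mx_scalar; apply/matrixP => i j; rewrite !mxE mulrC divpK //.
  by apply: eq_bigr => t _; rewrite !mxE.
have E : M *m block_mx (usubmx U) 0 (dsubmx U) 1%:M =
    row_mx B (rsubmx M) *m block_mx P%:M 0 0 1%:M.
  rewrite mul_row_block !mulmx0 mulmx1 addr0 add0r -MU.
  rewrite -{1}[M]hsubmxK mul_row_block mulmx0 mulmx1 add0r.
  by rewrite -mul_row_col hsubmxK vsubmxK.
have /(congr1 (fun A => \det A)) := E.
rewrite !det_mulmx !det_lblock !det1 !mulr1 det_scalar => {}E.
have {}E : \det M * \det (usubmx U) = \det (row_mx B (rsubmx M)) * P ^+ k by [].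
have : P ^+ k %| \det M * \det (usubmx U) by rewrite E dvdp_mull.
rewrite Gauss_dvdpl // coprimep_expl // prime_coprimep //.
have -> : usubmx U = Vandermonde k (\row_j r j).
  by apply/matrixP => i j; rewrite !mxE.
rewrite det_Vandermonde; apply/negP => /(prime_dvd_prod pP)/hasP[i _ /=].
move=> /(prime_dvd_prod pP)/hasP[j _ /andP[ij]]; rewrite !mxE; apply/negP/rP.
by rewrite neq_ltn ij.
Qed.

(** The rows of the Sylvester matrix are the coefficients of the multiples [f * 'X^k] and
    [x * 'X^k]. *)
Lemma Sylvester_mx_horner f x (r : {poly F}) i : f != 0 -> x != 0 ->
  \sum_t Sylvester_mx f x i t * r ^+ t =
  match split i with inl k => f.[r] * r ^+ k | inr k => x.[r] * r ^+ k end.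
Proof.
move=> f0 x0.
have aux (u : {poly {poly F}}) k : u != 0 ->
  (k + size u <= (size x).-1 + (size f).-1)%N ->
    \sum_(t < (size x).-1 + (size f).-1) (u`_(t - k) *+ (k <= t)%N) * r ^+ t =
    u.[r] * r ^+ k.
  move=> u0 su; transitivity (u * 'X^k).[r].
    rewrite (@horner_coef_wide _ ((size x).-1 + (size f).-1)); last first.
      by rewrite size_mulXn // addnC.
    apply: eq_bigr => t _; rewrite coefMXn ltnNge; case: leqP => _ //=.
  by rewrite hornerM hornerXn.
rewrite (eq_bigr (fun t : 'I__ => match split i with
    inl k => f`_(t - k) *+ (k <= t)%N * r ^+ t
  | inr k => x`_(t - k) *+ (k <= t)%N * r ^+ t end)); last first.
  by move=> t _; rewrite Sylvester_mxE; case: split.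
case: (splitP i) => [k ik|k ik].
  by apply: aux => //; rewrite [in leqLHS](polySpred f0) addnS -addSn leq_add2r.
by apply: aux => //; rewrite addnC [in leqLHS](polySpred x0) addSn -addnS
  leq_add2l.
Qed.

Lemma resultant_dvd_exp P f x k (r : 'I_k -> {poly F}) : f != 0 -> x != 0 ->
  is_prime P -> (forall i j, i != j -> ~~ (P %| r j - r i)) ->
  (forall j, P %| f.[r j]) -> (forall j, P %| x.[r j]) ->
  (k <= (size x).-1 + (size f).-1)%N -> P ^+ k %| resultant f x.
Proof.
move=> f0 x0 pP rP rf rx kS; rewrite /resultant.
have MP i j : P %| \sum_t Sylvester_mx f x i t * r j ^+ t.
  by rewrite Sylvester_mx_horner //; case: split => t; rewrite dvdp_mulr.
move: (Sylvester_mx f x) MP; rewrite -(subnKC kS) => M MP.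
exact: (det_dvd_exp pP rP).
Qed.

Lemma size_det_le N (M : 'M[{poly F}]_N) (e : 'I_N -> nat) :
  (forall i j, size (M i j) <= (e i).+1)%N ->
    (size (\det M) <= (\sum_i e i).+1)%N.
Proof.
move=> sM; apply: (leq_trans (size_sum _ _ _)); apply/bigmax_leqP => s _.
have -> : size ((-1) ^+ s * \prod_i M i (s i)) = size (\prod_i M i (s i)).
  by case: (odd_perm s); rewrite ?expr1 ?expr0 ?mul1r // mulN1r size_polyN.
apply: (big_ind2 (fun (y : {poly F}) n => (size y <= n.+1)%N)) => //.
  by rewrite size_poly1.
move=> y m z n ym zn; apply: leq_trans (size_polyMleq _ _) _.
by move: ym zn; case: (size y) => [|sy]; case: (size z) => [|sz]; lia.
Qed.

(** Each term of the determinant takes one entry per row, from [(size x).-1] rows of coefficients of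
    [f] and [(size f).-1] rows of coefficients of [x]. *)
Lemma size_resultant_le f x C m : (forall i, size (f`_i)%R <= C.+1)%N ->
  (forall i, size (x`_i)%R <= m.+1)%N ->
  (size (resultant f x) <= ((size x).-1 * C + (size f).-1 * m).+1)%N.
Proof.
move=> fC xm.
have -> : ((size x).-1 * C + (size f).-1 * m =
    \sum_(i < (size x).-1 + (size f).-1)
       if (i < (size x).-1)%N then C else m)%N.
  rewrite big_split_ord /=; congr addn.
    rewrite -[in LHS](card_ord (size x).-1) -sum_nat_const.
    by apply: eq_bigr => i _; rewrite ltn_ord.
  rewrite -[in LHS](card_ord (size f).-1) -sum_nat_const.
  by apply: eq_bigr => i _; rewrite ltnNge leq_addr.
apply: size_det_le => i j; rewrite Sylvester_mxE /=.
by case: (splitP i) => k _; case: (leqP k j) => _ /=;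
  rewrite ?mulr1n ?mulr0n ?size_poly0.
Qed.

End Determinants.

(** * Counting roots modulo prime powers *)

Lemma card_fibers_le (T U : finType) (A : {set T}) (h : T -> U) b :
  (forall y, #|[set x in A | h x == y]| <= b)%N -> (#|A| <= #|h @: A| * b)%N.
Proof.
move=> hb; rewrite -sum1_card (partition_big_imset h) /= -sum_nat_const.
apply: leq_sum => y _; apply: leq_trans (hb y); rewrite -sum1_card.
by rewrite leq_eqVlt; apply/orP; left; apply/eqP/eq_bigl => x; rewrite inE.
Qed.

Section Counting.
Variable F : finFieldType.
Implicit Types (P Q a : {poly F}) (f : {poly {poly F}}).

Lemma modp_eq_dvd a Q Q' : (Q %% a == Q' %% a) = (a %| Q - Q').
Proof. by rewrite -subr_eq0 -modpN -modpD /dvdp. Qed.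

(** The target is finite, so that residues can be counted; for [m = deg a] the remainder always
    fits. *)
Definition residue m a Q : {poly_m F} := npolyp m (Q %% a).

Lemma residue_eq a Q Q' : a != 0 ->
  (residue (deg a) a Q == residue (deg a) a Q') = (a %| Q - Q').
Proof.
move=> a0; have sz R : (size (R %% a)%R <= deg a)%N.
  by rewrite -ltnS -size_deg // ltn_modp.
rewrite -modp_eq_dvd; apply/eqP/eqP => [/(congr1 val)|];
  last by rewrite /residue => ->.
by rewrite /= !npolypK.
Qed.

Lemma val_residue a Q : a != 0 -> val (residue (deg a) a Q) = Q %% a.
Proof. by move=> a0; rewrite /= npolypK // -ltnS -size_deg // ltn_modp. Qed.

Lemma dvdp_horner_sub f a Q Q' : a %| Q - Q' -> a %| f.[Q] - f.[Q'].
Proof.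
move=> aQ; have [w] := horner_taylor2 f Q' (Q - Q').
rewrite [Q' + _]addrC subrK => ->.
have -> : f.[Q'] + f^`().[Q'] * (Q - Q') + (Q - Q') ^+ 2 * w - f.[Q'] =
  (Q - Q') * (f^`().[Q'] + (Q - Q') * w) by ring.
exact: dvdp_mulr.
Qed.

Lemma dvdp_horner_congr f a Q Q' : a %| Q - Q' -> (a %| f.[Q]) = (a %| f.[Q']).
Proof.
by move=> /(dvdp_horner_sub f) h; rewrite -[f.[Q]](subrK f.[Q']) dvdp_addr.
Qed.

(** Pigeonhole: [A] meets at most [d] residue classes modulo [a], each holding at most [b]
    elements. *)
Lemma card_classes_le (T : finType) (A : {set T}) (phi : T -> {poly F}) a d b :
  a != 0 ->
  (forall s : 'I_d.+1 -> T, (forall i, s i \in A) ->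
     exists i i' : 'I_d.+1, (i < i')%N /\ a %| phi (s i') - phi (s i)) ->
  (forall B : {set T}, {in B &, forall u v, a %| phi u - phi v} ->
    (#|B| <= b)%N) ->
  (#|A| <= d * b)%N.
Proof.
move=> a0 hA hB; pose h u := residue (deg a) a (phi u).
apply: (@leq_trans (#|h @: A| * b)).
  apply: card_fibers_le => y; apply: hB => u v; rewrite !inE.
  by move=> /andP[_ /eqP hu] /andP[_ /eqP hv];
    rewrite -residue_eq // -/(h u) hu -hv.
rewrite leq_mul2r; apply/orP; right; rewrite leqNgt; apply/negP => dA.
have H i : exists v, (v \in A) && (h v == enum_val (widen_ord dA i)).
  have /imsetP[v vA ->] := enum_valP (widen_ord dA i).
  by exists v; rewrite vA eqxx.
pose s i := xchoose (H i).
have sP i : (s i \in A) /\ h (s i) = enum_val (widen_ord dA i).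
  by have /andP[? /eqP] := xchooseP (H i).
have [i [i' [ii']]] := hA s (fun i => (sP i).1).
rewrite -residue_eq // -/(h _) -/(h (s i)) (sP i).2 (sP i').2 =>
  /eqP /enum_val_inj.
by move=> /(congr1 val) /= E; rewrite E ltnn in ii'.
Qed.

(* The members of M_n, parametrised by their lower coefficients. *)
Definition mon n (v : 'rV[F]_n) : {poly F} := 'X^n + rVpoly v.

Lemma mon_sub n (u v : 'rV[F]_n) : mon u - mon v = rVpoly (u - v).
Proof. by rewrite /mon linearB /=; ring. Qed.

Lemma size_mon n (v : 'rV[F]_n) : size (mon v) = n.+1.
Proof. by rewrite /mon size_polyDl size_polyXn // ltnS size_poly. Qed.

Lemma mon_monic n (v : 'rV[F]_n) : mon v \is monic.
Proof.
by rewrite monicE /mon lead_coefDl ?lead_coefXn // size_polyXn ltnS size_poly.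
Qed.

(* The subtraction is truncated: for n < deg a the bound is 1. *)
Lemma card_congruent_le n a (B : {set 'rV[F]_n}) : a != 0 ->
  {in B &, forall u v, a %| mon u - mon v} -> (#|B| <= #|F| ^ (n - deg a))%N.
Proof.
move=> a0 hB; have [->|[v0 v0B]] := set_0Vmem B; first by rewrite cards0.
pose psi (v : 'rV[F]_n) : {poly_(n - deg a) F} :=
  npolyp _ ((mon v - mon v0) %/ a).
have psiE v : val (psi v) = (mon v - mon v0) %/ a.
  rewrite /= npolypK // size_divp // mon_sub leq_sub2r //; exact: size_poly.
rewrite -card_npoly -(card_in_imset (f := psi)) ?max_card // => u v uB vB.
move=> /(congr1 val); rewrite !psiE => E.
have : mon u - mon v0 = mon v - mon v0.
  by rewrite -(divpK (hB _ _ uB v0B)) -(divpK (hB _ _ vB v0B)) E.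
rewrite !mon_sub => /(can_inj rVpolyK); exact: addIr.
Qed.

Lemma prime_exp_dvd_cancel P a b i m : is_prime P -> ~~ (P ^+ i %| a) ->
  P ^+ (i + m) %| a * b -> P ^+ m %| b.
Proof.
move=> pP na Pab.
have a0 : a != 0 by apply: contraNneq na => ->; rewrite dvdp0.
have ti : (vp P a < i)%N by rewrite ltnNge vp_geE.
have /dvdpP[a' Ea] := dvdp_vp a0 pP.
have P0 := prime_neq0 pP.
have na' : ~~ (P %| a').
  have : ~~ (vp P a < vp P a)%N by rewrite ltnn.
  by rewrite vp_gtE // [in X in _ %| X]Ea exprS dvdp_mul2r ?expf_neq0.
move: (vp P a) ti Ea => t ti Ea; move: Pab;
  rewrite -(subnKC (ltnW ti)) -addnA exprD Ea mulrAC [X in _ %| X]mulrC.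
rewrite dvdp_mul2l ?expf_neq0 // Gauss_dvdpr; last first.
  by rewrite coprimep_expl // prime_coprimep.
by apply: dvdp_trans; rewrite dvdp_exp2l // leq_addl.
Qed.

(** Each factor absorbs fewer than [j] powers of [P]. The allowance [size r * j] also counts indices
    outside [A], so that it depends on the length of [r] only. *)
Lemma prime_exp_dvd_prod P (I : Type) (r : seq I) (A : pred I)
    (G : I -> {poly F}) j m b :
  is_prime P -> (forall i, A i -> ~~ (P ^+ j %| G i)) ->
  P ^+ (size r * j + m) %| (\prod_(i <- r | A i) G i) * b -> P ^+ m %| b.
Proof.
move=> pP nG; elim: r => [|i r IH]; first by rewrite big_nil mul1r.
rewrite big_cons mulSn -addnA; case: ifP => Ai.
  by rewrite -mulrA => /(prime_exp_dvd_cancel pP (nG _ Ai)).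
by move=> h; apply: IH; apply: dvdp_trans h; rewrite dvdp_exp2l // leq_addl.
Qed.

(** If no difference were divisible by [P ^+ j], no inner product in the Vandermonde determinant
    would be divisible by [P ^+ (d.+1 * j + 1)]; after the [d.+1] inner products, [P ^+ m] would
    remain for the coefficient f_d. *)
Lemma roots_congruent_exp P f d j m (s : 'I_d.+1 -> {poly F}) :
  is_prime P -> (size f <= d.+1)%N -> ~~ (P ^+ m %| f`_d) ->
  (forall i, P ^+ (d.+1 * (d.+1 * j + 1) + m) %| f.[s i]) ->
  exists i i' : 'I_d.+1, (i < i')%N /\ P ^+ j %| s i' - s i.
Proof.
move=> pP sf nf Ps.
have [/existsP[i /existsP[i' /andP[ii' h]]]|] :=
    boolP [exists i : 'I_d.+1, [exists i' : 'I_d.+1,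
      (i < i')%N && (P ^+ j %| s i' - s i)]].
  by exists i, i'.
move=> /existsPn nex; case/negP: nf.
have nex' (i i' : 'I_d.+1) : (i < i')%N -> ~~ (P ^+ j %| s i' - s i).
  by move=> ii'; have /existsPn/(_ i') := nex i; rewrite ii'.
have := vandermonde_dvd sf Ps; rewrite mulrC.
have sz : size (index_enum 'I_d.+1) = d.+1.
  by rewrite -sum1_size sum1_card card_ord.
rewrite -{1}sz; apply: prime_exp_dvd_prod => // i _; apply/negP.
rewrite -[X in _ %| X]mulr1 -{1}sz => /(prime_exp_dvd_prod pP (nex' i)).
by rewrite expr1 dvdp1; have [+ _] := prime_irr pP; case: (size P) => [|[|]].
Qed.

Lemma roots_congruent P f d (s : 'I_d.+1 -> {poly F}) :
  is_prime P -> (size f <= d.+1)%N -> ~~ (P %| f`_d) ->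
  (forall i, P %| f.[s i]) ->
  exists i i' : 'I_d.+1, (i < i')%N /\ P %| s i' - s i.
Proof.
move=> pP sf nf Ps; have := vandermonde_dvd sf Ps.
rewrite prime_dvdM // (negPf nf) /= => /(prime_dvd_prod pP)/hasP[i _ /=].
by move=> /(prime_dvd_prod pP)/hasP[i' _ /andP[ii' h]]; exists i, i'.
Qed.

Definition nroots f n a : nat := #|[set v : 'rV[F]_n | a %| f.[mon v]]|.

Definition rho f P : nat := #|[set r : {poly_(deg P) F} | P %| f.[val r]]|.

Lemma rho_le P f d : is_prime P -> (size f <= d.+1)%N -> ~~ (P %| f`_d) ->
  (rho f P <= d)%N.
Proof.
move=> pP sf nf; rewrite -[d]muln1; have P0 := prime_neq0 pP.
apply: (@card_classes_le _ _ val P) => // [s sA|B hB].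
  by apply: (roots_congruent pP sf nf) => i; have := sA i; rewrite inE.
apply/card_le1_eqP => u v uB vB; apply/val_inj/eqP; rewrite -subr_eq0.
apply: contraLR (hB _ _ vB uB) => h; apply/negP => D; have := dvdp_leq h D.
rewrite size_deg // ltnNge; apply/negP/negPn.
apply: leq_trans (size_polyD _ _) _; rewrite size_polyN geq_max.
by rewrite !size_npoly.
Qed.

(** Serves at the primes where lifts may fail to be unique: roots modulo [P ^+ k] still lie in at
    most [d] classes, but modulo [P ^+ j] with [k] linear in [j]. *)
Lemma nroots_exp_le P f d n j m k : is_prime P -> (size f <= d.+1)%N ->
  ~~ (P ^+ m %| f`_d) -> (d.+1 * (d.+1 * j + 1) + m <= k)%N ->
  (nroots f n (P ^+ k) <= d * #|F| ^ (n - j * deg P))%N.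
Proof.
move=> pP sf nf jk; have P0 := prime_neq0 pP.
have Pj0 : P ^+ j != 0 by rewrite expf_neq0.
apply: (@card_classes_le _ _ (@mon n) (P ^+ j)) => // [s sA|B hB]; last first.
  by rewrite -degX //; apply: card_congruent_le.
apply: (roots_congruent_exp pP sf nf) => i; have := sA i; rewrite inE.
by apply: dvdp_trans; rewrite dvdp_exp2l.
Qed.

Lemma nroots_le P f d n : is_prime P -> (size f <= d.+1)%N -> ~~ (P %| f`_d) ->
  (n <= deg P)%N -> (nroots f n P <= d)%N.
Proof.
move=> pP sf nf nP; have P0 := prime_neq0 pP; rewrite -[d]muln1.
apply: (@card_classes_le _ _ (@mon n) P) => // [s sA|B hB].
  by apply: (roots_congruent pP sf nf) => i; have := sA i; rewrite inE.
have := card_congruent_le P0 hB.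
have -> : (n - deg P)%N = 0%N by lia.
by rewrite expn0.
Qed.

(** Roots modulo [P ^+ k.+1] that agree modulo [P] agree modulo [P ^+ k.+1], so each root modulo [P]
    accounts for one class. *)
Lemma nroots_good_le P f n k : is_prime P ->
  (forall Q Q', P ^+ k.+1 %| f.[Q] -> P ^+ k.+1 %| f.[Q'] -> P %| Q' - Q ->
     P ^+ k.+1 %| Q' - Q) ->
  (nroots f n (P ^+ k.+1) <= rho f P * #|F| ^ (n - k.+1 * deg P))%N.
Proof.
move=> pP gP; have P0 := prime_neq0 pP.
rewrite /nroots; set A := [set v | _].
pose h (v : 'rV[F]_n) := residue (deg P) P (mon v).
apply: (@leq_trans (#|h @: A| * #|F| ^ (n - k.+1 * deg P))).
  apply: card_fibers_le => y; rewrite -degX //; apply: card_congruent_le.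
    by rewrite expf_neq0.
  move=> u v; rewrite !inE => /andP[Pu /eqP hu] /andP[Pv /eqP hv].
  by apply: gP => //; rewrite -residue_eq // -/(h u) hu -hv.
rewrite leq_mul2r; apply/orP; right; apply: subset_leq_card.
apply/subsetP => _ /imsetP[v + ->]; rewrite !inE val_residue // => Pv.
have : P %| mon v - mon v %% P by rewrite -modp_eq_dvd modp_id.
move=> /(dvdp_horner_congr f) <-; apply: dvdp_trans Pv.
by rewrite exprS dvdp_mulr.
Qed.

End Counting.

(** * The Mertens upper bound *)

Lemma sum_geometric_le q N : (1 < q)%N ->
  (\sum_(t < N.+1) q ^ t <= 2 * q ^ N)%N.
Proof.
move=> q1; elim: N => [|N IH]; first by rewrite big_ord_recr big_ord0.
rewrite big_ord_recr /= [leqRHS]mulSn mul1n leq_add2r; apply: leq_trans IH _.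
by rewrite expnS leq_mul2r q1 orbT.
Qed.

Section Mertens.
Variable F : finFieldType.
Implicit Types (P Q a : {poly F}) (f : {poly {poly F}}).

(** * The box of polynomials with bounded degrees in X and T *)

Section Box.
Variables (d m : nat).
Implicit Types A B : {ffun 'I_d -> {poly_m F}}.

Definition box_poly A : {poly {poly F}} :=
  \poly_(i < d) (if insub i is Some j then val (A j) else 0).

Lemma coef_box_poly A (j : 'I_d) : (box_poly A)`_j = val (A j).
Proof. by rewrite coef_poly ltn_ord valK. Qed.

Lemma size_box_poly A : (size (box_poly A) <= d)%N.
Proof. exact: size_poly. Qed.

Lemma size_coef_box_poly A i : (size ((box_poly A)`_i)%R <= m)%N.
Proof.
rewrite coef_poly; case: ifP => _; last by rewrite size_poly0.
by case: insubP => [j _ _|_]; rewrite ?size_poly0 ?size_npoly.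
Qed.

Lemma box_polyB A B : box_poly (A - B) = box_poly A - box_poly B.
Proof.
apply/polyP => i; rewrite coefB !coef_poly; case: ifP => _;
  last by rewrite subrr.
by case: insubP => [j _ _|_]; rewrite ?subrr // !ffunE.
Qed.

Lemma box_poly_inj : injective box_poly.
Proof.
move=> A B AB; apply/ffunP => j; apply: val_inj.
by rewrite -!coef_box_poly AB.
Qed.

Lemma box_poly0 : box_poly 0 = 0.
Proof. by rewrite -(subrr 0) box_polyB subrr. Qed.

Lemma card_box : #|{ffun 'I_d -> {poly_m F}}| = (#|F| ^ (d * m))%N.
Proof. by rewrite card_ffun card_npoly card_ord -expnM mulnC. Qed.

(** Evaluation at [Q] modulo [P] is additive with at most [#|F| ^ deg P] values, and each of its
    fibres translates into the kernel. *)
Lemma card_box_kernel_ge P Q : P != 0 ->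
  (#|F| ^ (d * m) <= #|F| ^ deg P * #|[set A | (P %| (box_poly A).[Q])%R]|)%N.
Proof.
move=> P0; rewrite -card_box -cardsT; set K := [set A | _].
pose h A := residue (deg P) P (box_poly A).[Q].
apply: (@leq_trans (#|h @: setT| * #|K|)); last first.
  by rewrite leq_mul2r -[X in (_ <= X)%N]card_npoly max_card orbT.
apply: card_fibers_le => y; set B := [set A in _ | _].
have [->|[A0]] := set_0Vmem B; first by rewrite cards0.
rewrite !inE /= => /eqP hA0.
have inj : injective (fun A => A - A0) by move=> A A' /addIr.
rewrite -(card_imset _ inj); apply/subset_leq_card/subsetP => _ /imsetP[A + ->].
rewrite !inE /= box_polyB hornerD hornerN => /eqP hA.
by rewrite -residue_eq // -/(h A) -/(h A0) hA hA0.
Qed.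

End Box.

Definition common_roots f x P : nat :=
  #|[set r : {poly_(deg P) F} | (P %| f.[val r]) && (P %| x.[val r])]|.

Lemma common_roots_le_vp f x P d :
  is_prime P -> size f = d.+1 -> ~~ (P %| f`_d) ->
  x != 0 -> resultant f x != 0 ->
  (common_roots f x P <= vp P (resultant f x))%N.
Proof.
move=> pP sf nf x0 R0; have P0 := prime_neq0 pP.
have f0 : f != 0 by rewrite -size_poly_gt0 sf.
rewrite vp_geE // /common_roots; set S := [set r | _].
have SP i : (P %| f.[val (enum_val i : {poly_(deg P) F})]) &&
    (P %| x.[val (enum_val (A := S) i : {poly_(deg P) F})]).
  by have := enum_valP i; rewrite inE.
apply: (@resultant_dvd_exp _ P f x #|S| (fun i => val (enum_val i))) => //.
- move=> i j; apply: contra => D; apply/eqP/enum_val_inj/val_inj/eqP.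
  rewrite eq_sym -subr_eq0; apply: contraLR (D) => h; apply/negP => D';
    have := dvdp_leq h D'.
  rewrite size_deg // ltnNge; apply/negP/negPn.
  apply: leq_trans (size_polyD _ _) _; rewrite size_polyN geq_max.
  by rewrite !size_npoly.
- by move=> j; have /andP[] := SP j.
- by move=> j; have /andP[] := SP j.
(* The common roots number at most [rho f P <= d], and the Sylvester matrix has at least [d]
   rows. *)
rewrite sf /=; apply: leq_trans (leq_addl _ _).
apply: leq_trans (rho_le pP _ nf); last by rewrite sf.
by apply/subset_leq_card/subsetP => r; rewrite !inE => /andP[].
Qed.

(** Double counting of the pairs of a box element and a root; the excluded element 0 shares every
    root of [f], whence [rho f P]. *)
Lemma sum_common_roots f P d m :
  (\sum_(A : {ffun 'I_d -> {poly_m F}} | A != 0%R)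
      common_roots f (box_poly A) P + rho f P =
   \sum_(r : {poly_(deg P) F} | (P %| f.[val r])%R)
      #|[set A : {ffun 'I_d -> {poly_m F}} | (P %| (box_poly A).[val r])%R]|)%N.
Proof.
have -> : rho f P = common_roots f (box_poly (0 : {ffun 'I_d -> {poly_m F}})) P.
  by apply: eq_card => r; rewrite !inE box_poly0 horner0 dvdp0 andbT.
transitivity (\sum_(A : {ffun 'I_d -> {poly_m F}})
    common_roots f (box_poly A) P)%N.
  by rewrite [RHS](bigD1 (0 : {ffun 'I_d -> {poly_m F}})) //= addnC.
rewrite (eq_bigr (fun A => \sum_(r : {poly_(deg P) F} | (P %| f.[val r])%R)
   (P %| (box_poly A).[val r])%R)%N).
  rewrite exchange_big /=; apply: eq_bigr => r _.
  by rewrite -sum1_card [RHS]big_mkcond /=; apply: eq_bigr => A _; rewrite inE;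
    case: (_ %| _).
move=> A _; rewrite /common_roots -sum1_card big_mkcond [RHS]big_mkcond /=.
by apply: eq_bigr => r _; rewrite inE; case: (P %| _); case: (P %| _).
Qed.

(** For each nonzero box element, the weighted common roots add up to at most the degree of the
    resultant, [d * C + d * m]. The last sum pays for the zero element. *)
Lemma mertens_box f d m C (s : seq {poly F}) :
  ring_irreducible f -> size f = d.+1 ->
  (0 < m)%N -> (forall i, size (f`_i)%R <= C.+1)%N ->
  uniq s -> all (@is_prime F) s -> all (fun P => ~~ (P %| f`_d)) s ->
  all (fun P => (deg P <= d * m)%N) s ->
  (\sum_(P <- s) deg P * rho f P * #|F| ^ (d * m - deg P) <=
   #|F| ^ (d * m) * (d * C + d * m) + \sum_(P <- s) deg P * d)%N.
Proof.
move=> irr sf m0 fC us ps gs ds.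
pose T := {ffun 'I_d -> {poly_m F}}.
have q0 : (0 < #|F|)%N by apply: ltnW; apply: finNzRing_gt1.
have step P : P \in s -> (deg P * rho f P * #|F| ^ (d * m - deg P) <=
   \sum_(A : T | A != 0%R) deg P * common_roots f (box_poly A) P + deg P * d)%N.
  move=> Ps; have pP := allP ps _ Ps; have nP := allP gs _ Ps;
    have dP := allP ds _ Ps.
  have P0 := prime_neq0 pP.
  have rd : (rho f P <= d)%N by apply: rho_le => //; rewrite sf.
  rewrite -big_distrr /= -mulnDr -mulnA leq_mul2l; apply/orP; right.
  apply: (@leq_trans (\sum_(A : T | A != 0%R) common_roots f (box_poly A) P +
    rho f P)); last first.
    by rewrite leq_add2l.
  rewrite sum_common_roots -sum_nat_const.
  rewrite [leqLHS](eq_bigl (fun r : {poly_(deg P) F} => P %| f.[val r]));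
    last by move=> r; rewrite inE.
  apply: leq_sum => r _.
  rewrite -(@leq_pmul2l (#|F| ^ deg P)) ?expn_gt0 ?q0 // -expnD subnKC //.
  exact: card_box_kernel_ge.
apply: (@leq_trans (\sum_(P <- s) (\sum_(A : T | A != 0%R)
    deg P * common_roots f (box_poly A) P + deg P * d))).
  by rewrite big_seq [leqRHS]big_seq; apply: leq_sum.
rewrite big_split /= leq_add2r exchange_big /=.
apply: (@leq_trans (\sum_(A : T | A != 0%R) (d * C + d * m))); last first.
  rewrite sum_nat_const leq_mul2r; apply/orP; right.
  by rewrite -(card_box d m) max_card.
apply: leq_sum => A A0.
have x0 : box_poly A != 0.
  by apply: contraNneq A0 => h; apply/eqP/box_poly_inj; rewrite h box_poly0.
have R0 : resultant f (box_poly A) != 0.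
  by apply: irreducible_resultant_neq0 => //; rewrite sf ltnS size_box_poly.
apply: (@leq_trans (\sum_(P <- s) deg P * vp P (resultant f (box_poly A)))).
  rewrite big_seq [leqRHS]big_seq; apply: leq_sum => P Ps.
  rewrite leq_mul2l (@common_roots_le_vp _ _ _ d) ?orbT //.
    exact: (allP ps).
  exact: (allP gs).
apply: leq_trans (sum_deg_vp_le us ps R0) _.
have xm i : (size ((box_poly A)`_i)%R <= (m.-1).+1)%N.
  by rewrite prednK ?size_coef_box_poly.
rewrite -ltnS -size_deg //; apply: leq_trans (size_resultant_le fC xm) _.
rewrite ltnS sf /= leq_add //; last by rewrite leq_mul2l leq_pred orbT.
rewrite leq_mul2r; apply/orP; right;
  apply: leq_trans (leq_pred _) (size_box_poly A).
Qed.

Lemma sum_deg_primes_le n :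
  (\sum_(P <- primes_upto F n) deg P <= 2 * #|F| ^ n)%N.
Proof.
rewrite sum_primes_upto.
apply: leq_trans (sum_geometric_le n (finNzRing_gt1 F)).
by apply: leq_sum => t _; apply: sum_deg_primes_deg.
Qed.

Lemma mertens f d C : ring_irreducible f -> size f = d.+1 -> (0 < d)%N ->
  (forall i, size (f`_i)%R <= C.+1)%N -> forall n,
  (\sum_(P <- primes_upto F n | ~~ (P %| f`_d)%R)
      deg P * rho f P * #|F| ^ (n - deg P) <=
   (n + d * (C + 3)) * #|F| ^ n)%N.
Proof.
move=> irr sf d0 fC n; rewrite -big_filter; set s := [seq P <- _ | _].
have q0 : (0 < #|F|)%N by apply: ltnW; apply: finNzRing_gt1.
have us : uniq s by rewrite filter_uniq ?uniq_primes_upto.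
have sP P : P \in s -> [/\ is_prime P, (deg P <= n)%N & ~~ (P %| f`_d)].
  by rewrite mem_filter mem_primes_upto => /and3P[].
(* Then [n <= d * m <= n + d]: the box is large enough for primes of degree [n], yet the resultants
   have degree [n + O(1)]. *)
pose m := (n %/ d).+1.
have nm : (n <= d * m)%N by rewrite mulnC ltnW // ltn_ceil.
have mn : (d * m <= n + d)%N.
  by rewrite /m mulnS addnC leq_add2r mulnC leq_trunc_div.
have := @mertens_box f d m C s irr sf isT fC us.
have -> : all (@is_prime F) s by apply/allP => P /sP[].
have -> : all (fun P => ~~ (P %| f`_d)) s by apply/allP => P /sP[].
have -> : all (fun P => (deg P <= d * m)%N) s.
  by apply/allP => P /sP[_ + _] => dP; apply: leq_trans nm.
move=> /(_ isT isT isT).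
have -> : (\sum_(P <- s) deg P * rho f P * #|F| ^ (d * m - deg P) =
  #|F| ^ (d * m - n) * \sum_(P <- s) deg P * rho f P * #|F| ^ (n - deg P))%N.
  rewrite big_distrr /= big_seq [RHS]big_seq; apply: eq_bigr => P /sP[_ dP _].
  rewrite mulnCA; congr (_ * _)%N; rewrite -expnD; congr expn; lia.
have : (\sum_(P <- s) deg P * d <= 2 * d * #|F| ^ n)%N.
  rewrite -big_distrl /= mulnAC leq_mul2r; apply/orP; right.
  apply: leq_trans (sum_deg_primes_le n).
  by rewrite big_filter big_mkcond; apply: leq_sum => P _; case: ifP.
have -> : (#|F| ^ (d * m) = #|F| ^ (d * m - n) * #|F| ^ n)%N.
  by rewrite -expnD subnK.
have : (0 < #|F| ^ (d * m - n))%N by rewrite expn_gt0 q0.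
move: (#|F| ^ (d * m - n))%N (#|F| ^ n)%N => u v.
move: (\sum_(P <- s) deg P * d)%N => E.
move: (\sum_(P <- s) deg P * rho f P * #|F| ^ (n - deg P))%N => S.
move=> u0 hE h.
rewrite -(leq_pmul2l u0); apply: leq_trans h _.
(* Of [d * (C + 3)], the part [d * C + d] comes from the resultants and [2 * d] from the zero box
   element. *)
apply: (@leq_trans (u * v * (d * C + (n + d)) + u * (2 * d * v))).
  apply: leq_add; first by rewrite leq_mul2l leq_add2l mn orbT.
  by apply: leq_trans hE _; rewrite leq_pmull.
apply: eq_leq; ring.
Qed.

End Mertens.

(** * The contribution of small primes *)

(** Truncated subtraction makes every term with [k >= N] equal to 1; the summand [K] pays for
    these. *)
Lemma sum_geometric_trunc_le q N K : (1 < q)%N ->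
  (\sum_(k < K) q ^ (N - k) <= 2 * q ^ N + K)%N.
Proof.
move=> q1; elim: K N => [|K IH] N; first by rewrite big_ord0.
rewrite big_ord_recl /= subn0.
under eq_bigr => i _ do rewrite /bump /= add1n subnS -subn1 subnAC subn1.
apply: (leq_trans (leq_add (leqnn _) (IH N.-1))).
case: N => [|N] /=; first by rewrite expn0; lia.
rewrite expnS; move: (q ^ N)%N => u; nia.
Qed.

Lemma sum_geometric_step_le q N m K : (1 < q)%N -> (0 < m)%N ->
  (\sum_(k < K) q ^ (N - k * m) <= 2 * q ^ N + K)%N.
Proof.
move=> q1 m0; apply: leq_trans (sum_geometric_trunc_le N K q1).
apply: leq_sum => k _; rewrite leq_exp2l //.
by rewrite leq_sub2l // leq_pmulr.
Qed.

Lemma sum_divn (g : nat -> nat) G j :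
  (\sum_(k < j * G) g (k %/ G) = G * \sum_(i < j) g i)%N.
Proof.
elim: j => [|j IH]; first by rewrite mul0n !big_ord0 muln0.
have -> : (j.+1 * G = j * G + G)%N by rewrite mulSn addnC.
rewrite big_split_ord /= IH big_ord_recr /= mulnDr; congr addn.
rewrite -[in RHS](card_ord G) -sum_nat_const; apply: eq_bigr => i _.
by rewrite divnMDl ?divn_small ?addn0 // (leq_ltn_trans _ (ltn_ord i)).
Qed.

Lemma sum_geometric_divn_le q N G K : (1 < q)%N -> (0 < G)%N ->
  (\sum_(k < K) q ^ (N - k %/ G) <= G * (2 * q ^ N + K))%N.
Proof.
move=> q1 G0; apply: (@leq_trans (\sum_(k < K * G) q ^ (N - k %/ G))).
  rewrite -!(big_mkord xpredT (fun k => q ^ (N - k %/ G)))%N.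
  rewrite [leqRHS](@big_cat_nat _ _ _ K) //=; first exact: leq_addr.
  by rewrite leq_pmulr.
rewrite (sum_divn (fun j => q ^ (N - j))%N) leq_mul2l; apply/orP; right.
exact: sum_geometric_trunc_le.
Qed.

Lemma sum_weighted_geometric_le q n : (1 < q)%N ->
  (\sum_(m < n.+1) (n - m).+1 * q ^ m <= 4 * q ^ n)%N.
Proof.
move=> q1; elim: n => [|n IH]; first by rewrite big_ord_recr big_ord0.
rewrite big_ord_recr /= subnn mul1n.
have -> : (\sum_(i < n.+1) (n.+1 - i).+1 * q ^ i =
   \sum_(i < n.+1) (n - i).+1 * q ^ i + \sum_(i < n.+1) q ^ i)%N.
  rewrite -big_split /=; apply: eq_bigr => i _.
  by rewrite subSn 1?mulSn 1?addnC //; have := ltn_ord i; lia.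
have := sum_geometric_le n q1; move: IH.
move: (\sum_(i < n.+1) (n - i).+1 * q ^ i)%N (\sum_(i < n.+1) q ^ i)%N => S T.
rewrite expnS; move: (q ^ n)%N => u; nia.
Qed.

Section PrimeSums.
Variable F : finFieldType.
Local Notation q := #|F|.

(** Write [n = (n - m) + m] at degree [m]: the number of primes, and also [m] times it, is at most
    [q ^ m], which gives the weight [(n - m).+1]. *)
Lemma card_primes_upto_le n : (n * size (primes_upto F n) <= 4 * q ^ n)%N.
Proof.
apply: leq_trans (sum_weighted_geometric_le n (finNzRing_gt1 F)).
rewrite -sum1_size sum_primes_upto big_distrr /=; apply: leq_sum => m _.
rewrite sum1_size; have mn : (m <= n)%N by rewrite -ltnS.
have hm : (m * size (primes_deg F m) <= q ^ m)%N.
  apply: leq_trans (sum_deg_primes_deg F m).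
  rewrite -sum1_size big_distrr /= big_seq [leqRHS]big_seq; apply: leq_sum => P.
  by rewrite mem_primes_deg => /andP[_ /eqP ->]; rewrite muln1.
have hc : (size (primes_deg F m) <= q ^ m)%N.
  have [m0|m0] := posnP m; last by apply: leq_trans hm; rewrite leq_pmull.
  rewrite m0; have : primes_deg F 0 = [::].
    case E : (primes_deg F 0) => [//|P s].
    have : P \in primes_deg F 0 by rewrite E mem_head.
    by rewrite mem_primes_deg => /andP[/prime_deg_gt0 + /eqP]; lia.
  by move=> ->.
rewrite -{1}(subnK mn) mulnDl mulSn addnC; apply: leq_add hm _.
by rewrite leq_mul2l hc orbT.
Qed.

Lemma sum_primes_restrict (A : pred {poly F}) (G : {poly F} -> nat) M N :
  (M <= N)%N ->
  (\sum_(P <- primes_upto F N | A P && (deg P <= M)) G P =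
   \sum_(P <- primes_upto F M | A P) G P)%N.
Proof.
move=> MN; rewrite -big_filter -[RHS]big_filter; apply/perm_big/uniq_perm.
- by rewrite filter_uniq ?uniq_primes_upto.
- by rewrite filter_uniq ?uniq_primes_upto.
move=> P; rewrite !mem_filter !mem_primes_upto; case: (A P) => //=.
by case: (is_prime P); rewrite ?andbF //=; apply/andP/idP => [[]|]; lia.
Qed.

(** Degree [t] contributes at most [q ^ t * q ^ (n - 2 * t)], that is [q ^ (n - t)] while
    [2 * t <= n] and [q ^ t] beyond. *)
Lemma sum_primes_square_le n E :
  (\sum_(P <- primes_upto F (n + E)) deg P * q ^ (n - 2 * deg P) <=
   (2 + 3 * q ^ E) * q ^ n)%N.
Proof.
have q1 := finNzRing_gt1 F.
rewrite sum_primes_upto.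
apply: (@leq_trans (\sum_(t < (n + E).+1) (q ^ (n - t) + q ^ t))).
  apply: leq_sum => t _; apply: (@leq_trans (q ^ t * q ^ (n - 2 * t))).
    apply: (@leq_trans ((\sum_(P <- primes_deg F t) deg P) * q ^ (n - 2 * t))).
      rewrite big_distrl /= big_seq [leqRHS]big_seq; apply: leq_sum => P.
      by rewrite mem_primes_deg => /andP[_ /eqP ->].
    by rewrite leq_mul2r sum_deg_primes_deg orbT.
  rewrite -expnD; have [h|h] := leqP (2 * t)%N n.
    by apply: leq_trans (leq_addr _ _); rewrite leq_exp2l //; lia.
  by apply: leq_trans (leq_addl _ _); rewrite leq_exp2l //; lia.
rewrite big_split /=; apply: leq_trans (leq_add (sum_geometric_trunc_le _ _ q1)
  (sum_geometric_le _ q1)) _.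
have := ltn_expl (n + E) q1; rewrite expnD.
move: (q ^ n)%N (q ^ E)%N => u v; lia.
Qed.

Lemma sum_deg_dvd_le (s : seq {poly F}) (D : {poly F}) : D != 0 ->
  uniq s -> all (@is_prime F) s ->
  (\sum_(P <- s | (P %| D)%R) deg P <= deg D)%N.
Proof.
move=> D0 us ps; apply: leq_trans (sum_deg_vp_le us ps D0).
rewrite big_mkcond /= big_seq [leqRHS]big_seq; apply: leq_sum => P Ps.
case: ifP => // PD; rewrite leq_pmulr // vp_geE ?expr1 //; exact: (allP ps).
Qed.

End PrimeSums.

(** * Valuations summed over the values f(Q) *)

Section Values.
Variables (F : finFieldType) (f : {poly {poly F}}) (d C : nat).
Hypotheses (d_ge2 : (2 <= d)%N) (size_f : size f = d.+1).
Hypothesis f_irr : ring_irreducible f.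
Hypothesis coef_f : (forall i, size (f`_i)%R <= C.+1)%N.
Local Notation q := #|F|.

Let q1 : (1 < q)%N. Proof. exact: finNzRing_gt1. Qed.
Let q0 : (0 < q)%N. Proof. exact: ltnW. Qed.

Lemma f_d_neq0 : f`_d != 0.
Proof.
have := lead_coefE f; rewrite size_f /= => <-.
by rewrite lead_coef_eq0; case: f_irr.
Qed.

Lemma value_neq0 Q : f.[Q] != 0.
Proof. by apply: irreducible_horner_neq0 => //; rewrite size_f. Qed.

Lemma deg_value n (v : 'rV[F]_n) : (C < n)%N ->
  (d * n <= deg f.[mon v] <= d * n + C)%N.
Proof.
move=> Cn; rewrite horner_coef size_f big_ord_recr /=.
have m0 : mon v != 0 by rewrite -size_poly_gt0 size_mon.
have dm : deg (mon v) = n by rewrite /deg size_mon.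
have sm k : size (mon v ^+ k) = (k * n).+1.
  by rewrite size_deg ?expf_neq0 // degX // dm.
have sl : (size (\sum_(i < d) f`_i * mon v ^+ i)%R < (d * n).+1)%N.
  rewrite ltnS; apply: leq_trans (size_sum _ _ _) _; apply/bigmax_leqP => i _.
  apply: leq_trans (size_polyMleq _ _) _; rewrite sm addnS /=.
  have := coef_f i; have := ltn_ord i; move: (size _) => w; nia.
have fd0 := f_d_neq0.
have st : size (f`_d * mon v ^+ d) = (deg f`_d + d * n).+1.
  by rewrite size_mul ?expf_neq0 // sm addnS size_deg.
have fdC : (deg f`_d <= C)%N by rewrite -ltnS -size_deg.
rewrite addrC /deg size_polyDl st; first by rewrite /= leq_addl addnC leq_add2l.
by apply: leq_trans sl _; rewrite ltnS leq_addl.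
Qed.

Lemma sum_vp_value P n K : is_prime P -> (C < n)%N ->
  (d * n + C <= K * deg P)%N ->
  (\sum_(v : 'rV[F]_n) vp P f.[mon v] = \sum_(k < K) nroots f n (P ^+ k.+1))%N.
Proof.
move=> pP Cn hK.
rewrite (eq_bigr (fun v => \sum_(k < K) (P ^+ k.+1 %| f.[mon v])%R)%N);
  last first.
  move=> v _; apply: vp_sum => //; first exact: value_neq0.
  by apply: leq_trans hK; have /andP[] := deg_value v Cn.
rewrite exchange_big /=; apply: eq_bigr => k _; rewrite /nroots -sum1_card.
by rewrite [RHS]big_mkcond; apply: eq_bigr => v _; rewrite inE; case: (_ %| _).
Qed.

(** For [j >= 1], exponents from [j * G] on are large enough for [nroots_exp_le] with classes modulo
    [P ^+ j]; by degrees, [P ^+ C.+1] does not divide f_d. *)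
Let G := (d.+1 * d.+1 + d.+1 + C.+1)%N.

Lemma sum_vp_bad P n : is_prime P -> (C < n)%N ->
  (\sum_(v : 'rV[F]_n) vp P f.[mon v] <= d * (G * (2 * q ^ n + (d * n + C))))%N.
Proof.
move=> pP Cn; have P1 := prime_deg_gt0 pP.
rewrite (@sum_vp_value _ _ (d * n + C)) ?leq_pmulr //.
apply: (@leq_trans (\sum_(k < d * n + C) d * q ^ (n - k %/ G))); last first.
  by rewrite -big_distrr leq_mul2l sum_geometric_divn_le ?orbT // /G addnS.
apply: leq_sum => k _; have [k0|k0] := posnP (k %/ G)%N.
  rewrite k0 subn0; apply: (@leq_trans (q ^ n));
    last by rewrite leq_pmull // ltnW.
  by apply: leq_trans (max_card _) _; rewrite card_mx mul1n.
apply: (@leq_trans (d * q ^ (n - (k %/ G) * deg P))); last first.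
  by rewrite leq_mul2l leq_exp2l // leq_sub2l ?orbT // leq_pmulr.
apply: (@nroots_exp_le _ _ _ _ _ _ C.+1) => //; first by rewrite size_f.
  apply/negP => /deg_dvdp /(_ f_d_neq0); rewrite degX ?prime_neq0 // => h.
  have fdC : (deg f`_d <= C)%N by rewrite -ltnS -size_deg ?f_d_neq0.
  by have := leq_trans h fdC; nia.
have := leq_trunc_div k G; rewrite {2}/G; move: (k %/ G)%N k0 => j; nia.
Qed.

(** The first power of [P] gives the term bounded on average by [mertens]. The higher ones form a
    geometric series from [q ^ (n - 2 * deg P)], with an excess of at most 1 for each of [K] powers,
    where [deg P * K <= d * n + C]. *)
Lemma sum_vp_good P n : is_prime P -> (C < n)%N -> ~~ (P %| f`_d) ->
  (forall k Q Q', P ^+ k %| f.[Q] -> P ^+ k %| f.[Q'] -> P %| Q' - Q ->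
     P ^+ k %| Q' - Q) ->
  (deg P * \sum_(v : 'rV[F]_n) vp P f.[mon v] <=
   deg P * rho f P * q ^ (n - deg P) +
   d * (2 * (deg P * q ^ (n - 2 * deg P)) + (d * n + C)))%N.
Proof.
move=> pP Cn nP gP; have P1 := prime_deg_gt0 pP.
pose K := ((d * n + C) %/ deg P)%N.
have hK : (d * n + C <= K.+1 * deg P)%N by rewrite ltnW // ltn_ceil.
have KP : (deg P * K <= d * n + C)%N by rewrite mulnC leq_trunc_div.
have rd : (rho f P <= d)%N by apply: rho_le => //; rewrite size_f.
rewrite (sum_vp_value pP Cn hK) big_ord_recl mulnDr /=; apply: leq_add.
  rewrite -mulnA leq_mul2l; apply/orP; right.
  by have := @nroots_good_le _ P f n 0 pP (gP 1%N); rewrite mul1n.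
apply: (@leq_trans (deg P * (d * (2 * q ^ (n - 2 * deg P) + K)))); last first.
  rewrite mulnCA leq_mul2l; apply/orP; right; rewrite mulnDr mulnCA.
  by rewrite leq_add2l.
rewrite leq_mul2l; apply/orP; right.
apply: (@leq_trans (\sum_(k < K) d * q ^ (n - 2 * deg P - k * deg P)));
  last first.
  by rewrite -big_distrr leq_mul2l sum_geometric_step_le ?orbT.
apply: leq_sum => k _; rewrite /bump /= add1n.
apply: leq_trans (nroots_good_le _ pP (gP _)) _; rewrite -subnDA -mulnDl.
by rewrite leq_mul2r rd orbT.
Qed.

Lemma sum_good_primes_le E (D : {poly F}) : f`_d %| D ->
  exists B, forall n, (C < n)%N ->
  (\sum_(P <- primes_upto F (n + E) | ~~ (P %| D)%R)
      (deg P * rho f P * q ^ (n - deg P) +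
       d * (2 * (deg P * q ^ (n - 2 * deg P)) + (d * n + C)))
   <= (n + B) * q ^ n)%N.
Proof.
move=> fD.
(* [B1] is the error in [mertens], [B2] covers the primes with [n < deg P <= n + E], and [B3] the
   higher powers, where the bound on the number of primes absorbs [d * n + C]. *)
pose B1 := (d * (C + 3))%N; pose B2 := (d * (2 * q ^ E))%N.
pose B3 := (d * (2 * (2 + 3 * q ^ E) + (d + C) * (4 * q ^ E)))%N.
exists (B1 + B2 + B3)%N => n Cn.
have nfd P : ~~ (P %| D) -> ~~ (P %| f`_d) by apply: contra => /dvdp_trans;
  apply.
rewrite big_split /= addnA mulnDl; apply: leq_add; last first.
  apply: (@leq_trans (\sum_(P <- primes_upto F (n + E))
     d * (2 * (deg P * q ^ (n - 2 * deg P)) + (d * n + C)))).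
    by rewrite big_mkcond; apply: leq_sum => P _; case: ifP.
  rewrite -big_distrr /B3 -mulnA leq_mul2l; apply/orP; right.
  rewrite big_split /= mulnDl; apply: leq_add.
    rewrite -big_distrr /= -mulnA leq_mul2l; apply/orP; right.
    exact: sum_primes_square_le.
  have := card_primes_upto_le F (n + E);
    rewrite big_const_seq count_predT iter_addn_0 expnD.
  move: (size _) (q ^ n)%N (q ^ E)%N => s u v h.
  apply: (@leq_trans ((d + C) * ((n + E) * s))); first by nia.
  by rewrite -!mulnA leq_mul2l; apply/orP; right; lia.
apply: (@leq_trans (\sum_(P <- primes_upto F (n + E) | ~~ (P %| D)%R)
   (if (deg P <= n)%N then deg P * rho f P * q ^ (n - deg P) else 0)%N +
    \sum_(P <- primes_upto F (n + E)) deg P * d)).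
  rewrite [X in (_ <= _ + X)%N](bigID (fun P => P %| D)) /= addnCA.
  apply: leq_trans (leq_addl _ _);
    rewrite -big_split /= big_seq_cond [leqRHS]big_seq_cond.
  apply: leq_sum => P; rewrite mem_primes_upto => /andP[/andP[pP _] nD].
  case: (leqP (deg P) n) => [_|h]; first exact: leq_addr.
  rewrite (_ : n - deg P = 0)%N ?muln1 ?leq_mul2l ?rho_le ?orbT ?size_f ?nfd //.
  by lia.
rewrite addnA mulnDl; apply: leq_add; last first.
  rewrite -big_distrl /= mulnC -mulnA leq_mul2l; apply/orP; right.
  apply: leq_trans (sum_deg_primes_le F (n + E)) _.
  by rewrite expnD mulnA mulnAC.
apply: leq_trans (mertens f_irr size_f (ltnW d_ge2) coef_f n).
rewrite -big_mkcondr sum_primes_restrict ?leq_addr //.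
rewrite big_mkcond [leqRHS]big_mkcond; apply: leq_sum => P _.
by case: ifP => // /nfd ->.
Qed.

End Values.

(** * The contribution of large primes to the lcm *)

Section Assembly.
Variables (F : finFieldType) (f : {poly {poly F}}) (d C : nat).
Hypotheses (d_ge2 : (2 <= d)%N) (size_f : size f = d.+1).
Hypothesis f_irr : ring_irreducible f.
Hypothesis coef_f : (forall i, size (f`_i)%R <= C.+1)%N.
Local Notation q := #|F|.

Lemma value_dvd_lcm n (v : 'rV[F]_n) : f.[mon v] %| lcm_values f n.
Proof.
have /lcm_valuesP := dvdpp (lcm_values f n); apply; first exact: mon_monic.
exact: size_mon.
Qed.

Lemma lcm_values_neq0 n : lcm_values f n != 0.
Proof.
have : lcm_values f n %| \prod_(Q <- monics F n) f.[Q].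
  apply/lcm_valuesP => Q Qm sQ.
  have QM : Q \in monics F n by rewrite mem_monics Qm sQ eqxx.
  by rewrite (big_rem Q QM) /= dvdp_mulr.
apply: contraTneq => ->; rewrite dvd0p prodf_seq_neq0.
by apply/allP => Q _ /=; apply: (value_neq0 d_ge2 size_f f_irr).
Qed.

(** Only values divisible by [P] contribute, each at most the valuation of the lcm: passing from the
    product to the lcm loses at most a factor [M] at [P]. *)
Lemma sum_vp_le_lcm P n M : is_prime P -> (nroots f n P <= M)%N ->
  (\sum_(v : 'rV[F]_n) vp P f.[mon v] <= M * vp P (lcm_values f n))%N.
Proof.
move=> pP nM; rewrite (bigID (fun v => P %| f.[mon v])) /= addnC big1;
  last first.
  move=> v; rewrite -[P in P %| _]expr1 -vp_geE //;
    first by rewrite lt0n negbK => /eqP.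
  exact: (value_neq0 d_ge2 size_f f_irr).
rewrite add0n; apply: (@leq_trans (nroots f n P * vp P (lcm_values f n))).
  rewrite /nroots -sum_nat_const.
  rewrite [leqRHS](eq_bigl (fun v : 'rV[F]_n => P %| f.[mon v]));
    last by move=> v; rewrite inE.
  by apply: leq_sum => v _; rewrite vp_dvd ?value_dvd_lcm ?lcm_values_neq0.
by rewrite leq_mul2r nM orbT.
Qed.

Lemma lcm_degree_lower M E N1 :
  (forall n P, (N1 <= n)%N -> is_prime P -> (n + E < deg P)%N ->
    (nroots f n P <= M)%N) ->
  exists B N0, forall n, (N0 <= n)%N ->
    (d.-1 * (n * q ^ n) <= M * deg (lcm_values f n) + B * q ^ n)%N.
Proof.
move=> large; have [|D D0 [fdD gD]] := good_modulus f_irr;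
  first by rewrite size_f.
rewrite lead_coefE size_f /= in fdD.
pose G := (d.+1 * d.+1 + d.+1 + C.+1)%N.
have [B hB] := @sum_good_primes_le F f d C d_ge2 size_f f_irr coef_f E D fdD.
(* The second summand covers the primes dividing [D]. The condition [E <= n] puts [n + E] below
   [d * n + C], which bounds the degree of any prime factor of a value. *)
exists (B + deg D * (d * (G * (2 + (d + C)))))%N, (maxn N1 (maxn C.+1 E)) => n.
rewrite !geq_max => /and3P[nN1 Cn nE].
pose V := (d * n + C)%N; pose L := lcm_values f n.
pose S P := (deg P * \sum_(v : 'rV[F]_n) vp P f.[mon v])%N.
have tot : (q ^ n * (d * n) <= \sum_(P <- primes_upto F V) S P)%N.
  apply: (@leq_trans (\sum_(v : 'rV[F]_n) deg f.[mon v])).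
    have -> : (q ^ n = #|{: 'rV[F]_n}|)%N by rewrite card_mx mul1n.
    rewrite -sum_nat_const; apply: leq_sum => v _.
    by have /andP[] := deg_value d_ge2 size_f f_irr coef_f v Cn.
  under [leqRHS]eq_bigr => P _ do rewrite /S big_distrr /=.
  rewrite exchange_big /=; apply: leq_sum => v _; apply: deg_le_sum_vp;
    first exact: (value_neq0 d_ge2 size_f f_irr).
  by have /andP[] := deg_value d_ge2 size_f f_irr coef_f v Cn.
have bad : (\sum_(P <- primes_upto F V | (P %| D)%R) S P <=
    deg D * (d * (G * (2 * q ^ n + V))))%N.
  apply: (@leq_trans (\sum_(P <- primes_upto F V | (P %| D)%R)
      deg P * (d * (G * (2 * q ^ n + V))))).
    rewrite big_seq_cond [leqRHS]big_seq_cond; apply: leq_sum => P /andP[].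
    rewrite mem_primes_upto => /andP[pP _] _; rewrite leq_mul2l; apply/orP;
      right.
    exact: sum_vp_bad.
  rewrite -big_distrl leq_mul2r; apply/orP; right.
  by apply: sum_deg_dvd_le; rewrite ?uniq_primes_upto ?all_primes_upto.
have good : (\sum_(P <- primes_upto F V | ~~ (P %| D)%R && (deg P <= n + E))
    S P <= (n + B) * q ^ n)%N.
  rewrite sum_primes_restrict; last by rewrite /V; move: d_ge2 nE; nia.
  apply: leq_trans (hB n Cn).
  rewrite big_seq_cond [leqRHS]big_seq_cond; apply: leq_sum => P /andP[].
  rewrite mem_primes_upto => /andP[pP _] nD; apply: sum_vp_good => //.
    by apply: contra nD => /dvdp_trans; apply.
  exact: gD.
have lrg : (\sum_(P <- primes_upto F V | ~~ (P %| D)%R && ~~ (deg P <= n + E))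
    S P <= M * deg L)%N.
  apply: leq_trans (leq_mul (leqnn M) (sum_deg_vp_le (uniq_primes_upto F V)
    (all_primes_upto F V) (lcm_values_neq0 n))).
  rewrite big_distrr /= big_mkcond big_seq [leqRHS]big_seq; apply: leq_sum => P.
  rewrite mem_primes_upto => /andP[pP _]; case: ifP => // /andP[_];
    rewrite -ltnNge => h.
  by rewrite mulnCA leq_mul2l sum_vp_le_lcm ?orbT ?large.
move: tot; rewrite (bigID (fun P => P %| D)) /=.
rewrite [X in (_ + X)%N](bigID (fun P => (deg P <= n + E)%N)) /=.
move: bad good lrg.
move: (\sum_(P <- _ | (P %| D)%R) S P)%N => S1.
move: (\sum_(P <- _ | ~~ (P %| D)%R && (deg P <= n + E)) S P)%N => S2.
move: (\sum_(P <- _ | ~~ (P %| D)%R && ~~ (deg P <= n + E)) S P)%N => S3.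
have Vq : (V <= (d + C) * q ^ n)%N.
  have nq := ltnW (ltn_expl n (finNzRing_gt1 F)).
  have q1 : (0 < q ^ n)%N by rewrite expn_gt0 (ltnW (finNzRing_gt1 F)).
  rewrite /V mulnDl leq_add ?leq_mul2l ?nq ?orbT //.
  by rewrite leq_pmulr.
have : (deg D * (d * (G * (2 * q ^ n + V))) <=
    deg D * (d * (G * (2 + (d + C)))) * q ^ n)%N.
  by rewrite -!mulnA !leq_mul2l mulnDl leq_add2l Vq !orbT.
move: (deg D * (d * (G * (2 + (d + C)))))%N.
move: (deg D * (d * (G * (2 * q ^ n + V))))%N => c' c.
move: (M * deg L)%N (q ^ n)%N => ML u h1 h2 h3 h4 h5.
rewrite -subn1 mulnBl mul1n leq_subLR.
have -> : (d * (n * u) = u * (d * n))%N by ring.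
apply: leq_trans h5 _; apply: leq_trans (leq_add h2 (leq_add h3 h4)) _.
have -> : (n * u + (ML + (B + c) * u) = c * u + ((n + B) * u + ML))%N by ring.
by rewrite leq_add2r.
Qed.

(** Such a [P] has degree too large to divide f_d, or to divide the difference of two distinct
    members of M_n. *)
Lemma nroots_lead_le n P : is_prime P -> (n + C < deg P)%N ->
  (nroots f n P <= d)%N.
Proof.
move=> pP h; apply: nroots_le => //; first by rewrite size_f.
  apply/negP => /deg_dvdp /(_ (f_d_neq0 size_f f_irr)).
  by have := coef_f d; rewrite size_deg ?(f_d_neq0 size_f f_irr) //; lia.
by lia.
Qed.

Lemma sum_mon_coef n k (s : 'I_k -> 'rV[F]_n) :
  (\sum_(i < k) mon (s i))`_n = k%:R.
Proof.
rewrite coef_sum (eq_bigr (fun=> 1)); first by rewrite sumr_const card_ord.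
by move=> i _; have /monicP := mon_monic (s i); rewrite lead_coefE size_mon.
Qed.

Lemma nroots_pred_le p n P : p \in [pchar F] ->
  ~~ (p %| d)%N \/ ~~ (f`_d %| f`_d.-1) -> (C < n)%N ->
  is_prime P -> (n + C < deg P)%N -> (nroots f n P <= d.-1)%N.
Proof.
move=> pF cond Cn pP h; have P0 := prime_neq0 pP.
have fd0 := f_d_neq0 size_f f_irr.
rewrite -[d.-1]muln1; apply: (@card_classes_le _ _ _ (@mon F n) P) =>
  // [s sA|B hB]; last first.
  have := card_congruent_le P0 hB.
  have -> : (n - deg P)%N = 0%N by lia.
  by rewrite expn0.
pose ps := [seq mon (s i) | i <- enum 'I_d.-1.+1].
have d1 : d.-1.+1 = d by lia.
have sps : size ps = d by rewrite size_map size_enum_ord.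
pose w : {poly {poly F}} := \prod_(Q <- ps) ('X - Q%:P).
have sw : size w = d.+1 by rewrite size_prod_XsubC sps.
have wm : w \is monic by apply: monic_prod_XsubC.
have wd : w`_d = 1 by have /monicP := wm; rewrite lead_coefE sw.
have wd1 : w`_d.-1 = - \sum_i mon (s i).
  have := @coefPn_prod_XsubC _ ps; rewrite sps => -> //; last by rewrite -lt0n;
    lia.
  by rewrite big_map big_enum.
pose y := f`_d.-1 + f`_d * \sum_i mon (s i).
have sS : (size (\sum_i mon (s i))%R <= n.+1)%N.
  apply: leq_trans (size_sum _ _ _) _; apply/bigmax_leqP => i _.
  by rewrite size_mon.
have y0 : y != 0.
  (* If [y = 0] then f_d divides f_(d-1). When [p] does not divide [d], the sum has coefficient [d],
     nonzero in [F], at T^n, so that f_(d-1) would have degree at least [n > C]. *)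
  apply/negP => /eqP y0; case: cond => [npd|/negP[]]; last first.
    have -> : f`_d.-1 = - (f`_d * \sum_i mon (s i)).
      by apply/eqP; rewrite -addr_eq0; apply/eqP.
    by rewrite dvdpNr dvdp_mulr.
  have Sn : (\sum_i mon (s i))`_n != 0.
    by rewrite sum_mon_coef d1 -(dvdn_pcharf pF).
  have S0 : \sum_i mon (s i) != 0 by apply: contraNneq Sn => ->; rewrite coef0.
  have nS : (n < size (\sum_i mon (s i))%R)%N.
    by rewrite ltnNge; apply: contra Sn => ?; rewrite nth_default.
  have E : f`_d * \sum_i mon (s i) = - f`_d.-1.
    by apply/eqP; rewrite -addr_eq0 addrC; apply/eqP.
  have := coef_f d.-1; rewrite -size_polyN -E size_mul // size_deg //.
  rewrite addSn /= => hC.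
  by have := leq_trans nS (leq_trans (leq_addl _ _) hC); rewrite ltnS leqNgt Cn.
have sy : (size y <= n + C + 1)%N.
  apply: leq_trans (size_polyD _ _) _; rewrite geq_max; apply/andP; split.
    by apply: leq_trans (coef_f _) _; lia.
  apply: leq_trans (size_polyMleq _ _) _.
  by have := coef_f d; move: sS; move: (size _) (size f`_d) => a b; lia.
have nPy : ~~ (P %| y).
  apply/negP => /dvdp_leq -/(_ y0) /leq_trans -/(_ _ sy).
  by rewrite size_deg // addn1 ltnS leqNgt h.
(* Subtracting [f_d *: w] cancels X^d and leaves [y] at X^(d-1). All [d] roots survive modulo [P],
   one more than the new degree allows for pairwise incongruent ones. *)
apply: (@roots_congruent _ P (f - f`_d *: w) d.-1 (fun i => mon (s i))) => //.
- apply/leq_sizeP => j; rewrite d1 leq_eqVlt coefB coefZ => /orP[/eqP <-|dj].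
    by rewrite wd mulr1 subrr.
  have fj : f`_j = 0 by rewrite nth_default // size_f.
  have wj : w`_j = 0 by rewrite nth_default // sw.
  by rewrite fj wj mulr0 subrr.
- by rewrite coefB coefZ wd1 mulrN opprK.
move=> i; rewrite hornerD hornerN hornerZ.
have -> : w.[mon (s i)] = 0.
  by apply/eqP; rewrite -[_ == 0]/(root w _) root_prod_XsubC; apply: map_f;
    rewrite mem_enum.
by rewrite mulr0 subr0; have := sA i; rewrite inE.
Qed.

End Assembly.

(** * Passage to the lower limit *)

Lemma asymp_ge_of_bound (R : realType) (U W : nat -> R) (B : R) (N0 : nat) :
  0 <= B -> (forall n, (N0 <= n)%N -> 0 < W n /\ (1 - B / n%:R) * W n <= U n) ->
  asymp_ge U W.
Proof.
move=> B0 h; rewrite /asymp_ge limn_einf_lim; apply/lee_subgt0Pr => e e0.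
rewrite (cvg_lim _ (@cvg_einfs_sup _ _)) //.
(* From [M] on, [B / n] is at most [e], so the infimum of this tail is at least [1 - e]; the lower
   limit is the supremum of such infima. *)
pose M := maxn N0 (Num.truncn (B / e)).+1.
apply: (@le_trans _ _ (einfs (fun n => (U n / W n)%:E) M)); last first.
  by apply: ereal_sup_ubound; exists M.
apply: le_ereal_inf_tmp => _ [n /= Mn] <-.
have /andP[nN0 nB] : (N0 <= n)%N && ((Num.truncn (B / e)).+1 <= n)%N by rewrite
  -geq_max.
have [W0 hU] := h n nN0.
rewrite -EFinB lee_fin ler_pdivlMr //; apply: le_trans hU.
rewrite ler_wpM2r ?(ltW W0) // lerB //.
have n0 : 0 < n%:R :> R by rewrite ltr0n; apply: leq_trans nB.
rewrite ler_pdivrMr // mulrC -ler_pdivrMr //.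
apply: ltW; apply: lt_le_trans (_ : (Num.truncn (B / e)).+1%:R <= _);
  last by rewrite ler_nat.
by apply: truncnS_gt.
Qed.

Theorem theorem1p4 (R : realType) (p e q : nat) (p_prime : prime p)
    (e_gt0 : (0 < e)%N) (q_def : q = (p ^ e)%N)
    (F : finFieldType) (cardF : #|F| = q)
    (f : {poly {poly F}}) (d : nat) (d_ge2 : (2 <= d)%N)
    (size_f : size f = d.+1) (f_irr : ring_irreducible f) :
  asymp_ge (fun n => (deg (lcm_values f n))%:R : R)
           (fun n => (d%:R - 1) / d%:R * (n%:R * q%:R ^+ n))
  /\
  ((~~ (p %| d)%N) \/ (~~ (f`_d %| f`_d.-1)) ->
   asymp_ge (fun n => (deg (lcm_values f n))%:R : R)
            (fun n => n%:R * q%:R ^+ n)).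
Proof.
have pF : p \in [pchar F] by apply: (@card_finPcharP _ p e) => //;
  rewrite cardF.
have [C coef_f] : exists C, forall i, (size (f`_i)%R <= C.+1)%N.
  exists (\max_(i < size f) size (f`_i)%R)%N => i.
  have [hi|hi] := ltnP i (size f); last by rewrite nth_default // size_poly0.
  apply: leqW.
  exact: (@leq_bigmax _ (fun j : 'I_(size f) => size f`_j) (Ordinal hi)).
have q1 : (1 < q)%N by rewrite -cardF finNzRing_gt1.
have d1 : (d.-1%:R : R) = d%:R - 1 by rewrite -subn1 natrB // ltnW.
(* Both parts are instances: [M = d] gives the factor (d-1)/d, and [M = d.-1] the factor 1. *)
have bound (M : nat) (W : nat -> R) : (0 < M)%N ->
    (forall n, W n = d.-1%:R / M%:R * (n%:R * q%:R ^+ n)) ->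
    (exists N1, forall n P, (N1 <= n)%N -> is_prime P -> (n + C < deg P)%N ->
      (nroots f n P <= M)%N) ->
    asymp_ge (fun n => (deg (lcm_values f n))%:R : R) W.
  move=> M0 WE [N1 large].
  have [B [N0 hB]] := lcm_degree_lower d_ge2 size_f f_irr coef_f large.
  have d0 : (0 : R) < d.-1%:R by rewrite ltr0n; lia.
  have M0' : (0 : R) < M%:R by rewrite ltr0n.
  apply: (@asymp_ge_of_bound _ _ _ (B%:R / d.-1%:R) (maxn N0 1));
    first by rewrite divr_ge0.
  move=> n; rewrite geq_max => /andP[nN0 n0].
  have n0' : (0 : R) < n%:R by rewrite ltr0n.
  have u0 : (0 : R) < q%:R ^+ n by rewrite exprn_gt0 // ltr0n ltnW.
  rewrite WE; split; first by rewrite !mulr_gt0 ?invr_gt0.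
  have := hB n nN0; rewrite cardF -(ler_nat R) !natrD !natrM !natrX.
  move: (q%:R ^+ n) u0 => u u0 hn.
  rewrite -(ler_pM2l M0').
  have -> : M%:R * ((1 - B%:R / d.-1%:R / n%:R) *
        (d.-1%:R / M%:R * (n%:R * u))) =
      d.-1%:R * (n%:R * u) - B%:R * u :> R.
    by field; rewrite !lt0r_neq0.
  by rewrite lerBlDr.
split.
  apply: (bound d) => [|n|]; first exact: ltnW.
    by rewrite d1.
  by exists 0%N => n P _ pP; apply: nroots_lead_le.
move=> cond; apply: (bound d.-1) => [|n|]; first by lia.
  by rewrite divff ?mul1r // pnatr_eq0; lia.
by exists C.+1 => n P Cn pP;
  apply: (nroots_pred_le d_ge2 size_f f_irr coef_f pF).
Qed.
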